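(* Let $D\ge1$ be an integer, let $\sigma$ be the left shift on $([0,1]^D)^{\mathbb{N}_0}$ (with the product topology), and let $\varphi:([0,1]^D)^{\mathbb{N}_0}\to\mathbb{R}$ be a continuous function. Then the mean dimension with potential satisfies $$\mathrm{mdim}\big(([0,1]^D)^{\mathbb{N}_0},\sigma,\varphi\big)=D+\sup_{\mu\in\mathcal{M}_\sigma(([0,1]^D)^{\mathbb{N}_0})}\int\varphi\,d\mu .$$
   Context: $\mathbb{N}_0=\{0,1,2,\dots\}$ and $\sigma((x_n)_{n\ge0})=(x_{n+1})_{n\ge0}$. $\mathcal{M}_\sigma(\cdot)$ is the set of $\sigma$-invariant Borel probability measures. Mean dimension with potential: let $T:\mathcal{Y}\to\mathcal{Y}$ be a continuous map on a compact metric space $(\mathcal{Y},d)$ and $\varphi:\mathcal{Y}\to\mathbb{R}$ continuous. A continuous map $f:\mathcal{Y}\to\mathcal{Z}$ into a topological space is an $\varepsilon$-embedding (with respect to $d$) if $\operatorname{diam}f^{-1}\{z\}<\varepsilon$ for every $z\in\mathcal{Z}$. For a simplicial complex $P$ and $a\in P$, $\dim_aP$ is the maximum of $\dim\Delta$ over all simplices $\Delta\subset P$ containing $a$. The $\varepsilon$-width dimension with potential $\mathrm{Widim}_\varepsilon(\mathcal{Y},d,\varphi)$ is the infimum of $\max_{y\in\mathcal{Y}}(\dim_{f(y)}P+\varphi(y))$ over all simplicial complexes $P$ and all $\varepsilon$-embeddings $f:\mathcal{Y}\to P$. For $N>0$ put $d_N(x,y)=\max_{0\le n\le N-1}d(T^nx,T^ny)$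 and $S_N\varphi(x)=\sum_{n=0}^{N-1}\varphi(T^nx)$. Then $$\mathrm{mdim}(\mathcal{Y},T,\varphi)=\lim_{\varepsilon\to0}\Big(\lim_{N\to\infty}\frac{\mathrm{Widim}_\varepsilon(\mathcal{Y},d_N,S_N\varphi)}{N}\Big),$$ where the value is independent of the choice of the metric $d$ compatible with the topology. *)

(* Defs.v *)
From HB Require Import structures.
From mathcomp Require Import all_boot all_order all_algebra finmap.
From mathcomp Require Import all_classical all_reals all_analysis.

Set Implicit Arguments.
Unset Strict Implicit.
Unset Printing Implicit Defensive.

Import Order.TTheory GRing.Theory Num.Theory.
Import numFieldNormedType.Exports.

Local Open Scope classical_set_scope.
Local Open Scope ring_scope.

(* Abstract simplicial complexes, possibly infinite. An element of [V] need not
   be a vertex: the vertices are the [v] such that [[fset v]] is a simplex. *)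
Record simplicial_complex (V : choiceType) := SimplicialComplex {
  simplices : set {fset V} ;
  simplices_neq0 : forall s, simplices s -> s != fset0%fset ;
  simplices_sub : forall s t, simplices s -> (t `<=` s)%fset -> t != fset0%fset ->
    simplices t }.

Section realization.
Context {R : realType} {V : choiceType}.

(* The closed simplex spanned by [s], in barycentric coordinates. Only finitely
   many coordinates vary on it, so that the topology induced by [{ptws V -> R}]
   is the Euclidean one. *)
Definition geometric_simplex (s : {fset V}) : set {ptws V -> R} :=
  [set t | [/\ forall v, 0 <= t v,
               forall v, v \notin s -> t v = 0 &
               \sum_(v <- s) t v = 1]].

Variable K : simplicial_complex V.

Record polyhedron := Polyhedron {
  bary : {ptws V -> R} ;
  baryP : exists2 s, simplices K s & geometric_simplex s bary }.

HB.instance Definition _ := gen_eqMixin polyhedron.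
HB.instance Definition _ := gen_choiceMixin polyhedron.

Definition simplex_incl (s : {fset V}) (Ks : simplices K s) (t : geometric_simplex s) :
    polyhedron :=
  Polyhedron (ex_intro2 _ _ s Ks (set_mem (svalP t))).

(* The weak (coherent) topology: a set is open iff its trace on every closed
   simplex is open. *)
Definition polyhedron_open (U : set polyhedron) : Prop :=
  forall s (Ks : simplices K s), open (simplex_incl Ks @^-1` U).

Let polyhedron_openT : polyhedron_open setT.
Proof. by move=> s Ks; rewrite preimage_setT; exact: openT. Qed.

Let polyhedron_openI : setI_closed polyhedron_open.
Proof. by move=> A B oA oB s Ks; apply: openI; [exact: oA|exact: oB]. Qed.

Let polyhedron_open_bigU (I : Type) (f : I -> set polyhedron) :
  (forall i, polyhedron_open (f i)) -> polyhedron_open (\bigcup_i f i).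
Proof.
move=> of_ s Ks; rewrite preimage_bigcup.
by apply: bigcup_open => i _; exact: of_.
Qed.

HB.instance Definition _ := isOpenTopological.Build polyhedron
  polyhedron_openT polyhedron_openI polyhedron_open_bigU.

(* [dim_a P]; the simplex spanned by [s] has dimension [#|` s| - 1]. *)
Definition local_dim (a : polyhedron) : \bar R :=
  ereal_sup [set (#|` s|.-1)%:R%:E | s in
    [set s | simplices K s /\ geometric_simplex s (bary a)]].

End realization.
Arguments polyhedron R {V} K.

Section mean_dimension.
Context {R : realType} {Y : topologicalType}.
Implicit Types (d : Y -> Y -> R) (T : Y -> Y) (phi : Y -> R) (eps : R).

Record compatible_metric d : Prop := CompatibleMetric {
  dist_ge0 : forall x y, 0 <= d x y ;
  dist_eq0 : forall x y, d x y = 0 <-> x = y ;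
  dist_sym : forall x y, d x y = d y x ;
  dist_triangle : forall x y z, d x z <= d x y + d y z ;
  dist_nbhs : forall x (A : set Y),
    nbhs x A <-> exists2 r, 0 < r & [set y | d x y < r] `<=` A }.

(* [-oo] on the empty set, which is harmless in [eps_embedding]. *)
Definition diam d (A : set Y) : \bar R :=
  ereal_sup [set (d x y)%:E | x in A & y in A].

Definition eps_embedding {Z : topologicalType} d eps (f : Y -> Z) : Prop :=
  continuous f /\ forall z, (diam d (f @^-1` [set z]) < eps%:E)%E.

Definition Widim eps d phi : \bar R :=
  ereal_inf [set w | exists (V : choiceType) (K : simplicial_complex V)
      (f : Y -> polyhedron R K), eps_embedding d eps f /\
      w = ereal_sup (range (fun y => local_dim (f y) + (phi y)%:E)%E)].

(* The base value [0] of the maximum is irrelevant, as metrics are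
   nonnegative. *)
Definition bowen_metric T d (N : nat) : Y -> Y -> R := fun x y =>
  \big[Num.max/0]_(0 <= n < N) d (iter n T x) (iter n T y).

Definition birkhoff_sum T phi (N : nat) : Y -> R := fun x =>
  \sum_(0 <= n < N) phi (iter n T x).

Definition Widim_rate T phi d eps (N : nat) : \bar R :=
  (Widim eps (bowen_metric T d N) (birkhoff_sum T phi N) * (N%:R^-1)%:E)%E.

Definition mdim_at_scale T phi d eps : \bar R := limn (Widim_rate T phi d eps).

Definition mdim T phi d : \bar R := lim (mdim_at_scale T phi d eps @[eps --> 0^'+]).

(* [lim] is total; this is the existence of the limits used in [mdim]. *)
Definition mdim_exists T phi d : Prop :=
  (forall eps, 0 < eps -> cvgn (Widim_rate T phi d eps)) /\
  cvg (mdim_at_scale T phi d eps @[eps --> 0^'+]).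

End mean_dimension.

Section invariant_measures.
Context (R : realType) {Y : ptopologicalType}.

Definition borel : Type := g_sigma_algebraType (@open Y).

HB.instance Definition _ := Measurable.on borel.

Definition invariant_probabilities (T : Y -> Y) : set (probability borel R) :=
  [set mu | forall A : set borel, measurable A -> mu (T @^-1` A) = mu A].

End invariant_measures.
Arguments borel Y : clear implicits.
Arguments invariant_probabilities R {Y} T.

Section full_shift.
Context (R : realType) (D : nat).

Definition unit_cube : set 'rV[R]_D := [set x | forall i, 0 <= x ord0 i <= 1].

Definition cube : Type := set_type unit_cube.

HB.instance Definition _ := Topological.on cube.

Let cube0 : 0 \in unit_cube.
Proof. by rewrite inE => i /=; rewrite mxE lexx ler01. Qed.

HB.instance Definition _ := isPointed.Build cube (exist _ 0 cube0).

Definition cube_sequences : Type := {ptws nat -> cube}.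

HB.instance Definition _ := Topological.on cube_sequences.
HB.instance Definition _ := isPointed.Build cube_sequences (fun=> point).

Definition left_shift (x : cube_sequences) : cube_sequences := fun n => x n.+1.

End full_shift.

(* Main.v *)
(* Lower bound: around any point [x] sits a cube of side [r] in the first [N]
   coordinates on which the Birkhoff sum is almost that of [x]; for small [eps]
   an [eps]-embedding [f] keeps its opposite faces apart, so it suffices to find
   in that cube a point [y] such that [f y] has more than [N D] nonzero
   barycentric coordinates. If there is none, then, after multiplying the
   barycentric coordinates by a large [M] and shifting them by one of [N D]
   phases, rounding down is locally constant near each point for at least one
   phase. Each phase thus gives a function on a fine grid that separates two
   opposite faces, and these [N D] functions are never all nonconstant on one
   grid cell, contradicting a discrete Poincare-Miranda theorem (a cochain
   argument modulo 2).

   Upper bound: the first [N + L] coordinates map the shift into a cube, which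
   embeds in a single simplex of dimension [D (N + L)].

   For fixed [eps], joins of complexes make the width dimension subadditive in
   [N] up to the constant 1, whence the limit by Fekete's lemma. Periodic orbits
   carry invariant measures whose integrals approach the largest Birkhoff
   averages. *)
From HB Require Import structures.
Require Import Defs.
From mathcomp Require Import all_boot all_order all_algebra finmap.
From mathcomp Require Import all_classical all_reals all_analysis measurable_realfun.
From mathcomp Require Import ring lra.

Set Implicit Arguments.
Unset Strict Implicit.
Unset Printing Implicit Defensive.

Import Order.TTheory GRing.Theory Num.Theory.
Import numFieldNormedType.Exports.

Local Open Scope classical_set_scope.
Local Open Scope ring_scope.

(** * Discrete Poincare-Miranda theorem *)

Section discrete_poincare_miranda.
Variables (n k : nat).
Local Notation point := ('I_n -> nat).
Implicit Types (p q : point) (i j : 'I_n) (I : {set 'I_n}) (s : seq 'I_n).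

Definition incr i p : point := fun l => (p l + (l == i))%N.

Definition upd i a p : point := fun l => if l == i then a else p l.

Lemma incrC i j p : incr i (incr j p) = incr j (incr i p).
Proof. by apply/funext => l; rewrite /incr -!addnA [X in (_ + X)%N]addnC. Qed.

Lemma incr_upd i a p : incr i (upd i a p) = upd i a.+1 p.
Proof.
by apply/funext => l; rewrite /incr /upd; case: eqP => _; rewrite (addn1, addn0).
Qed.

Lemma incr_updC i j a p : j != i -> incr i (upd j a p) = upd j a (incr i p).
Proof.
move=> ji; apply/funext => l; rewrite /incr /upd; case: eqP => // ->.
by rewrite (negPf ji) addn0.
Qed.

(** The vertices [q] of the lattice cube based at [p] with edge directions [I]. *)
Definition corner I p q := forall i, (p i <= q i <= p i + (i \in I))%N.

Variable u : 'I_n -> point -> 'F_2.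

(* The value on the cube [p + [0,1]^I] of the cup product of the coboundaries
   of the 0-cochains [u i], for [i] in [s]. *)
Fixpoint cup s p I : 'F_2 :=
  if s is j :: s' then
    \sum_(i in I) (u j (incr i p) - u j p) * cup s' (incr i p) (I :\ i)
  else (I == finset.set0)%:R.

(** Evaluation of a cochain on the face of the grid through [p] in the directions [s]: the base
    points of its cells have coordinates below [k] in these directions. *)
Fixpoint box s (F : point -> 'F_2) p : 'F_2 :=
  if s is i :: s' then \sum_(0 <= a < k) box s' F (upd i a p) else F p.

Lemma addF2 (x : 'F_2) : x + x = 0.
Proof. by rewrite -mulr2n -mulr_natr pchar_Fp_0 // mulr0. Qed.

Lemma oppF2 (x : 'F_2) : - x = x.
Proof. by apply/eqP; rewrite eq_sym -subr_eq0 opprK addF2. Qed.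

(** The terms of [(i, j)] and [(j, i)] are equal, so they cancel in characteristic 2. *)
Lemma sum_sym I (F : 'I_n -> 'I_n -> 'F_2) : (forall i j, F i j = F j i) ->
  \sum_(i in I) \sum_(j in I :\ i) F i j = 0.
Proof.
move=> Fsym.
have -> : \sum_(i in I) \sum_(j in I :\ i) F i j =
    \sum_(i in I) \sum_(j in I | (j < i)%N) F i j +
    \sum_(i in I) \sum_(j in I | (i < j)%N) F i j.
  rewrite -big_split /=; apply: eq_bigr => i Ii.
  rewrite (bigID (fun j : 'I_n => (j < i)%N)) /=; congr (_ + _).
    apply: eq_bigl => j; rewrite !inE andbAC; case: (ltngtP j i) => //=;
      rewrite ?andbF ?andbT //.
    by move=> ji; rewrite -(inj_eq val_inj) /= ltn_eqF.
  apply: eq_bigl => j; rewrite !inE andbAC -(inj_eq val_inj) /=.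
  by case: (ltngtP j i) => //=; rewrite ?andbF ?andbT.
rewrite [X in _ + X](exchange_big_dep (fun j => j \in I)) //=; last by move=> ? ? _ /andP[].
set x := (X in _ + X); rewrite -[RHS](addF2 x); congr (_ + _).
apply: eq_bigr => i Ii; apply: eq_big => [j|j _]; last exact: Fsym.
by rewrite Ii.
Qed.

(** A product of coboundaries is a cocycle: its values on the facets of a cube cancel, signs being
    irrelevant modulo 2. Expanding the first factor leaves double sums symmetric in two
    directions. *)
Lemma cup_closed s p I :
  \sum_(i in I) (cup s (incr i p) (I :\ i) - cup s p (I :\ i)) = 0.
Proof.
elim: s p I => [|j s IHs] p I /=.
  by rewrite big1 // => i _; rewrite subrr.
have IH q (J : {set 'I_n}) : \sum_(i in J) cup s (incr i q) (J :\ i) =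
    \sum_(i in J) cup s q (J :\ i).
  by apply/eqP; rewrite -subr_eq0 -sumrB IHs.
(* The mixed terms: [E1] produces [A i l] from the far facets and [E2] produces [A l i] from the
   near ones, so that together they are symmetric. *)
pose A i l := u j (incr i p) * cup s (incr i p) (I :\ i :\ l).
have sw (i l : 'I_n) : I :\ i :\ l = I :\ l :\ i.
  by apply/setP => x; rewrite !inE andbCA.
have E1 i : i \in I -> \sum_(l in I :\ i)
    (u j (incr l (incr i p)) - u j (incr i p)) *
      cup s (incr l (incr i p)) (I :\ i :\ l) =
    \sum_(l in I :\ i) (u j (incr l (incr i p)) *
      cup s (incr l (incr i p)) (I :\ i :\ l)) + \sum_(l in I :\ i) A i l.
  move=> _; under eq_bigr do rewrite mulrBl.
  by rewrite sumrB oppF2 -!mulr_sumr IH.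
under eq_bigr => i Ii do rewrite (E1 _ Ii).
have E2 i : \sum_(l in I :\ i) (u j (incr l p) - u j p) *
      cup s (incr l p) (I :\ i :\ l) =
    \sum_(l in I :\ i) A l i + \sum_(l in I :\ i) u j p * cup s p (I :\ i :\ l).
  under eq_bigr do rewrite mulrBl.
  rewrite sumrB oppF2 -!mulr_sumr IH; congr (_ + _).
  by apply: eq_bigr => l _; rewrite /A sw.
under eq_bigr => i Ii do rewrite E2 oppF2.
rewrite !big_split /= sum_sym; last by move=> i l; rewrite sw incrC.
rewrite add0r addrA.
rewrite [X in _ + X]sum_sym ?addr0; last by move=> i l; rewrite sw.
rewrite -big_split /=.
under eq_bigr do rewrite -big_split /=.
by apply: (@sum_sym I (fun i l => A i l + A l i)) => i l; rewrite addrC.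
Qed.

(** As the product over [s] is closed, multiplying it by the coboundary of [u j] gives the
    coboundary of [u j] times that product. This form can be telescoped. *)
Lemma cupE j s p I : cup (j :: s) p I = \sum_(i in I)
  (u j (incr i p) * cup s (incr i p) (I :\ i) - u j p * cup s p (I :\ i)).
Proof.
rewrite /=; under eq_bigr do rewrite mulrBl.
rewrite !sumrB -mulr_sumr; congr (_ - _); rewrite -mulr_sumr; congr (_ * _).
by apply/eqP; rewrite -subr_eq0 -sumrB cup_closed.
Qed.

(** A nonzero value has a nonzero summand, a product of increments of the functions along
    consecutive edges of a monotone path starting at [p]; each factor exhibits two corners with
    different values. *)
Lemma cup_neq0 s p I j : cup s p I != 0 -> j \in s ->
  exists q q', [/\ corner I p q, corner I p q' & u j q != u j q'].
Proof.
elim: s p I => [//|l s IHs] p I /=.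
have [[i Ii]|H] := pselect (exists2 i, i \in I &
    (u l (incr i p) - u l p) * cup s (incr i p) (I :\ i) != 0); last first.
  case/eqP; apply: big1 => i Ii; apply/eqP; apply: contrapT => /negP h.
  by apply: H; exists i.
rewrite mulf_eq0 negb_or subr_eq0 => /andP[neq E] _; rewrite inE.
have sub q : corner (I :\ i) (incr i p) q -> corner I p q.
  move=> + x => /(_ x); rewrite /incr !inE; case: eqVneq => [->|_] /=.
    by rewrite Ii addn0 => /andP[h ->]; rewrite andbT (leq_trans (leq_addr 1 _) h).
  by rewrite addn0.
case/predU1P => [->|js].
  exists (incr i p), p; split => // x; last by rewrite leqnn leq_addr.
  by rewrite /incr leq_addr leq_add2l /=; case: eqVneq => // ->; rewrite Ii.
by have [q [q' [/sub ? /sub ? ?]]] := IHs _ _ E js; exists q, q'.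
Qed.

(** Since [i] is not in [I], the cube lies in the hyperplane where coordinate [i] equals [a], and
    [u i] is constant there. *)
Lemma cup_eq0 s p I i a : (forall q, q i = a -> u i q = u i p) ->
  p i = a -> i \notin I -> i \in s -> cup s p I = 0.
Proof.
move=> ucst pi iI si; apply/eqP; apply: contrapT => /negP/cup_neq0/(_ si).
move=> [q [q' [/(_ i) + /(_ i) +]]]; rewrite (negPf iI) addn0 -!eqn_leq pi.
by move=> /eqP/esym/ucst -> /eqP/esym/ucst ->; rewrite eqxx.
Qed.

Lemma eq_box s F G p : F =1 G -> box s F p = box s G p.
Proof.
by move=> FG; elim: s p => [|i s IHs] p //=; apply: eq_bigr => a _; rewrite IHs.
Qed.

Lemma box_sum s (I : {set 'I_n}) (F : 'I_n -> point -> 'F_2) p :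
  box s (fun p => \sum_(i in I) F i p) p = \sum_(i in I) box s (F i) p.
Proof.
elim: s p => [|i s IHs] p //=; rewrite exchange_big /=.
by apply: eq_bigr => a _; rewrite IHs.
Qed.

Lemma boxB s F G p : box s (fun p => F p - G p) p = box s F p - box s G p.
Proof.
by elim: s p => [|i s IHs] p //=; rewrite -sumrB; apply: eq_bigr => a _.
Qed.

Lemma box_incr s F i p : i \notin s ->
  box s (fun p => F (incr i p)) p = box s F (incr i p).
Proof.
elim: s p => [|j s IHs] p //=; rewrite inE negb_or => /andP[ij si].
by apply: eq_bigr => a _; rewrite IHs// incr_updC// eq_sym.
Qed.

Lemma box_eq0 s F i p : i \notin s ->
  (forall q, q i = p i -> F q = 0) -> box s F p = 0.
Proof.
elim: s p => [|j s IHs] p /=; first by move=> _ ->.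
rewrite inE negb_or => /andP[ij si] F0; apply: big1 => a _.
by apply: IHs => // q; rewrite /upd (negPf ij); exact: F0.
Qed.

Lemma box_telescope s F i p : i \notin s ->
  box (i :: s) (fun p => F (incr i p) - F p) p =
  box s F (upd i k p) - box s F (upd i 0%N p).
Proof.
move=> si /=; rewrite -(telescope_sumr (fun a => box s F (upd i a p)) (leq0n k)).
by apply: eq_bigr => a _; rewrite boxB box_incr// incr_upd.
Qed.

Lemma box_telescope_eq0 s F i p : uniq s -> i \in s ->
  (forall q, q i = 0%N -> F q = 0) -> (forall q, q i = k -> F q = 0) ->
  box s (fun p => F (incr i p) - F p) p = 0.
Proof.
move=> + + F0 Fk; elim: s p => [//|j s IHs] p /andP[js us].
rewrite inE; case: (eqVneq i j) js => [<-|ij] js /=; last move=> si.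
  move=> _; rewrite -/(box (i :: s) _ p).
  rewrite box_telescope// !(@box_eq0 s F i)// ?subr0// => q.
  - by rewrite /upd eqxx => /F0.
  - by rewrite /upd eqxx => /Fk.
by apply: big1 => a _; exact: IHs.
Qed.

Hypothesis u0 : forall i p, p i = 0%N -> u i p = 1.
Hypothesis uk : forall i p, p i = k -> u i p = 0.

(** Stokes' theorem, by induction on [s]: only the boundary faces of the grid contribute to the
    coboundary given by [cupE]. *)
Lemma box_cup s p : uniq s -> box s (fun q => cup s q [set i in s]%SET) p = 1.
Proof.
elim: s p => [|j s IHs] p.
  move=> _ /=; suff -> : [set i in [::]]%SET = finset.set0 :> {set 'I_n} by rewrite eqxx.
  by apply/setP => i; rewrite !inE.
move=> ujs; have /andP[js us] := ujs.
under eq_box do rewrite cupE.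
rewrite box_sum (bigD1 j) /=; last by rewrite !inE eqxx.
rewrite [X in _ + X]big1 ?addr0; last first.
  move=> i; rewrite inE => /andP[ijs ij].
  (* On the two faces orthogonal to a direction [i] other than [j], the function [u i] is constant,
     so the product over [s], which contains [i], vanishes. *)
  pose G q : 'F_2 := u j q * cup s q ([set l in j :: s]%SET :\ i).
  have si : i \in s by move: ijs; rewrite inE (negPf ij).
  apply: (@box_telescope_eq0 (j :: s) G i) => // q qi; rewrite /G.
    rewrite (@cup_eq0 s q _ i 0%N) ?mulr0 ?inE ?eqxx// => q' q'i.
    by rewrite !u0.
  rewrite (@cup_eq0 s q _ i k) ?mulr0 ?inE ?eqxx// => q' q'i.
  by rewrite !uk.
(* In direction [j] the far face contributes 0 because [u j] is 0 there; the near face, where [u j]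
   is 1, leaves the integral for [s]. *)
pose G q : 'F_2 := u j q * cup s q ([set l in j :: s]%SET :\ j).
rewrite -/(box (j :: s) (fun p => G (incr j p) - G p) p).
rewrite (@box_telescope s G)// (@box_eq0 s G j (upd j k p))//; last first.
  by move=> q; rewrite /upd eqxx => qj; rewrite /G uk ?mul0r.
rewrite /G; have -> : [set l in j :: s]%SET :\ j = [set l in s]%SET.
  by apply/setP => l; rewrite !inE; case: eqVneq => // ->; rewrite (negPf js).
rewrite sub0r oppF2 -[RHS](IHs (upd j 0%N p) us).
apply/eqP; rewrite -subr_eq0 -boxB; apply/eqP; apply: (@box_eq0 _ _ j) => // q.
by rewrite /upd eqxx => qj; rewrite u0// mul1r subrr.
Qed.

End discrete_poincare_miranda.

(** The cup product of all the coboundaries has total 1 modulo 2 over the grid, so it is nonzero on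
    some cell, and no [u i] is constant there. *)
Lemma discrete_poincare_miranda (n k : nat) (u : 'I_n -> ('I_n -> nat) -> bool) :
  (forall i p, p i = 0%N -> u i p) -> (forall i p, p i = k -> ~~ u i p) ->
  exists p : 'I_n -> nat, forall i, exists q q',
    [/\ forall l, (p l <= q l <= (p l).+1)%N,
        forall l, (p l <= q' l <= (p l).+1)%N & u i q != u i q'].
Proof.
move=> u0 uk; pose v i p : 'F_2 := (u i p)%:R.
have := @box_cup n k v _ _ (enum 'I_n) (fun=> 0%N) (enum_uniq _).
have h0 i p : p i = 0%N -> v i p = 1 by move=> /u0; rewrite /v => ->.
have hk i p : p i = k -> v i p = 0 by move=> /uk/negPf; rewrite /v => ->.
move=> /(_ h0 hk) box1; apply: contrapT => H.
suff : box k (enum 'I_n) (fun q => cup v (enum 'I_n) q [set i in enum 'I_n]%SET)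
   (fun=> 0%N) = 0 by move/eqP; rewrite box1 oner_eq0.
rewrite (_ : (fun q => _) = (fun=> 0)).
  by elim: (enum 'I_n) (fun=> 0%N) => [//|i s IHs] p /=; rewrite big1.
apply/funext => p; apply/eqP; apply: contrapT => /negP cup0.
apply: H; exists p => i.
have [|q [q' [pq pq' uq]]] := cup_neq0 cup0 (j := i); first by rewrite mem_enum.
exists q, q'; split; last by apply: contraNneq uq; rewrite /v => ->.
- by move=> l; have := pq l; rewrite !inE mem_enum addn1.
- by move=> l; have := pq' l; rewrite !inE mem_enum addn1.
Qed.

(** * Compactness and polyhedra *)

Section compactness.
Context {R : realType}.

(** The near-covering form of compactness is applied to the finite sets of indices, directed by
    inclusion. *)
Lemma compact_cover_compact (X : topologicalType) (C : set X) :
  compact C -> cover_compact C.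
Proof.
move=> /compact_near_coveringP cC I D f fo CD.
pose F := filter_from [set: {fset I}] (fun S0 => [set S | S0 `<=` S]%fset).
have FF : Filter F.
  apply: filter_from_filter; first by exists fset0.
  move=> S1 S2 _ _; exists (S1 `|` S2)%fset => // S.
  by rewrite /= fsubUset => /andP[].
pose P (S : {fset I}) x := exists2 i, i \in S & D i /\ f i x.
have [|S _ SP] := cC {fset I} F P FF.
  move=> x /CD[i Di fi].
  exists (f i, [set S | [fset i] `<=` S]%fset).
    by split; [apply: open_nbhs_nbhs; split => //; exact: fo|exists [fset i]%fset].
  by move=> [y S] [/= fy]; rewrite fsub1set => iS; exists i.
(* [S] may contain indices outside [D], which are discarded. *)
exists [fset i in S | `[< D i >]]%fset.
  by move=> i; rewrite !inE => /andP[_ /asboolP].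
move=> x /(SP S (fsubset_refl _))[i iS [Di fi]]; exists i => //=.
by rewrite !inE iS; exact/asboolP.
Qed.

(** The open sets where [g a] exceeds some [1/(m+1)] cover [C]; a finite subcover yields finitely
    many functions and one common bound. *)
Lemma compact_positive (X : topologicalType) (A : choiceType) (C : set X)
    (g : A -> X -> R) : compact C -> (forall a, continuous (g a)) ->
  (forall x, C x -> exists a, 0 < g a x) ->
  exists (S : {fset A}) (e : R), 0 < e /\
    forall x, C x -> exists2 a, a \in S & e < g a x.
Proof.
move=> /compact_cover_compact cC gcont Cg.
pose f (i : A * nat) := g i.1 @^-1` [set r | i.2.+1%:R^-1 < r].
have [i _|x /Cg[a ga]|S _ CS] := cC (A * nat)%type setT f.
- by apply: open_comp => [x _|]; [exact: gcont|exact: open_gt].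
- have [m] := ltr_add_invr ga; rewrite add0r => hm.
  by exists (a, m).
pose M := (\max_(i <- S) i.2)%N.
exists [fset i.1 | i in S]%fset, M.+1%:R^-1; split; first by rewrite invr_gt0 ltr0n.
move=> x /CS[/= i iS fix_]; exists i.1; first by apply/imfsetP; exists i.
apply: le_lt_trans fix_; rewrite lef_pV2 ?posrE ?ltr0n// ler_nat ltnS.
by apply: (@leq_bigmax_seq _ _ xpredT snd).
Qed.

Lemma compact_set_type (X : topologicalType) (A : set X) :
  compact A -> compact [set: A].
Proof.
move=> cA F PF _.
have [|p [Ap cl]] := cA (set_val @ F) _.
  by apply: (@filterE _ F) => x; exact: set_valP.
exists (exist _ p (mem_set Ap)); split => // B C FB.
rewrite nbhsE => -[_ [[V oV <-] Vp] VC].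
have [] := cl (set_val @` B) V.
  change (F (set_val @^-1` (set_val @` B))).
  by apply: filterS FB => x Bx; exists x.
  by apply: open_nbhs_nbhs; split.
by move=> _ [[x Bx <-] Vx]; exists x; split => //; exact: VC.
Qed.

Lemma ptws_continuous (X T : topologicalType) (V : choiceType)
    (f : X -> {ptws V -> T}) :
  (forall v, continuous (fun x => f x v)) -> continuous f.
Proof.
move=> fcont x; apply/cvg_sup => v A.
rewrite nbhsE => -[_ [[B oB <-] Bx] BA].
suff : nbhs x (fun y => B (f y v)) by apply: filterS => y By; exact: BA.
by apply: fcont; apply: open_nbhs_nbhs; split.
Qed.

End compactness.

Section polyhedra.
Context {R : realType} {V : choiceType} (K : simplicial_complex V).
Implicit Types (a b : polyhedron R K) (s : {fset V}).
Local Open Scope fset_scope.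

Lemma bary_inj a b : bary a =1 bary b -> a = b.
Proof.
case: a b => [a pa] [b pb] /= /funext ab; rewrite {}ab in pa *.
by congr Polyhedron; exact: Prop_irrelevance.
Qed.

Lemma bary_ge0 a v : 0 <= bary a v.
Proof. by have [s _ []] := baryP a. Qed.

(** The coordinates already sum to 1 over some simplex, and the sum is the same over every finite
    set outside which they vanish. *)
Lemma geometric_simplexE a s :
  geometric_simplex s (bary a) <-> (forall v, v \notin s -> bary a v = 0).
Proof.
split=> [[]//|a0]; split => //; first exact: bary_ge0.
have [t _ [_ at0 at1]] := baryP a.
rewrite -at1; transitivity (\sum_(v <- s `&` t) bary a v).
  apply/esym/big_fset_incl; first exact: fsubsetIl.
  by move=> v vs; rewrite inE vs => /at0.
apply: big_fset_incl; first exact: fsubsetIr.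
by move=> v vt; rewrite inE vt andbT => /a0.
Qed.

Lemma supportP a : exists s, simplices K s /\ s =i [pred v | bary a v != 0].
Proof.
have [s Ks as_] := baryP a; have [_ a0 a1] := as_.
have E v : (v \in [fset v in s | bary a v != 0]) = (bary a v != 0).
  rewrite !inE /=; have [//|/a0 ->] := boolP (v \in s).
  by rewrite eqxx.
exists [fset v in s | bary a v != 0]; split => //.
apply: (simplices_sub Ks); first by apply/fsubsetP => v; rewrite !inE => /andP[].
apply: contra_eq_neq a1 => s0; rewrite eq_sym.
rewrite big1_seq ?oner_eq0// => v _; apply/eqP; apply: contraT.
by rewrite -E s0.
Qed.

(** The carrier of [a]: the smallest simplex that contains it. *)
Definition support a : {fset V} := projT1 (cid (supportP a)).

Lemma simplices_support a : simplices K (support a).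
Proof. by rewrite /support; case: cid => s []. Qed.

Lemma mem_support a v : (v \in support a) = (bary a v != 0).
Proof. by rewrite /support; case: cid => s [_ ->]. Qed.

Lemma geometric_simplex_support a s :
  geometric_simplex s (bary a) <-> support a `<=` s.
Proof.
rewrite geometric_simplexE; split => [h|/fsubsetP h v].
  by apply/fsubsetP => v; rewrite mem_support; apply: contraR => /h ->; rewrite eqxx.
by apply: contraNeq; rewrite -mem_support => /h.
Qed.

Lemma sum_support a s : support a `<=` s -> \sum_(v <- s) bary a v = 1.
Proof. by move=> /geometric_simplex_support[]. Qed.

Lemma local_dim_ge a s : simplices K s -> support a `<=` s ->
  ((#|` s|.-1)%:R%:E <= local_dim a)%E.
Proof.
by move=> Ks /geometric_simplex_support ?; apply: ereal_sup_ubound; exists s.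
Qed.

Lemma local_dim_ge0 a : (0 <= local_dim a)%E.
Proof.
apply: le_trans (local_dim_ge (simplices_support a) (fsubset_refl _)).
by rewrite lee_fin.
Qed.

Lemma simplex_coord_continuous s v :
  continuous (fun t : (geometric_simplex s : set {ptws V -> R}) => set_val t v).
Proof.
move=> t.
apply: (@continuous_comp _ _ _ set_val (fun f : {ptws V -> R} => f v) t).
  exact: initial_continuous.
exact: (@proj_continuous V (fun=> R) v).
Qed.

Lemma bary_continuous v : continuous (fun a => bary a v).
Proof.
apply/continuousP => U oU; change (polyhedron_open ((fun a => bary a v) @^-1` U)) => s Ks.
apply: (@open_comp _ _ (fun t : geometric_simplex s => set_val t v)) => // t _.
exact: simplex_coord_continuous.
Qed.

(** The image meets only the finitely many simplices inside [s], and on each of them weakly open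
    sets are traces of pointwise open sets; finitely many neighbourhoods of [x] are intersected. *)
Lemma polyhedron_continuous (X : topologicalType) (f : X -> polyhedron R K) s :
  (forall x, support (f x) `<=` s) -> (forall v, continuous (fun x => bary (f x) v)) ->
  continuous f.
Proof.
move=> fs fcont; apply/continuousP => U oU.
have trace t : exists W : set {ptws V -> R}, open W /\ forall x,
    simplices K t -> geometric_simplex t (bary (f x)) -> (U (f x) <-> W (bary (f x))).
  have [Kt|NKt] := pselect (simplices K t); last by exists setT; split; [exact: openT|].
  have [W oW WE] := oU t Kt; exists W; split => // x _ ft.
  have := congr1 (fun B => B (exist _ (bary (f x)) (mem_set ft))) WE.
  rewrite /preimage /= => ->; rewrite /simplex_incl.
  by set b := Polyhedron _; suff -> : b = f x by []; exact: bary_inj.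
pose W t := projT1 (cid (trace t)).
have oW t : open (W t) by rewrite /W; case: cid => ? [].
have WE t x : simplices K t -> geometric_simplex t (bary (f x)) ->
    U (f x) <-> W t (bary (f x)).
  by rewrite /W; case: cid => W' /= [_ h]; exact: h.
have bcont : continuous (fun x => bary (f x) : {ptws V -> R}).
  exact: ptws_continuous.
rewrite openE => x Ux; rewrite /interior.
have near1 t : simplices K t -> \forall y \near x, geometric_simplex t (bary (f y)) ->
    W t (bary (f y)).
  move=> Kt; have [ft|nft] := pselect (geometric_simplex t (bary (f x))).
    suff : nbhs x (fun y => W t (bary (f y))) by apply: filterS => y Wy _; exact: Wy.
    by apply: bcont; apply: open_nbhs_nbhs; split => //; exact: (WE t x Kt ft).1.
  (* If [f x] is not in the simplex [t], a coordinate outside [t] is nonzero at [x], hence near [x],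
     and nearby images avoid [t] as well. *)
  have [v vt fv] : exists2 v, v \notin t & bary (f x) v != 0.
    apply: contrapT => h; apply: nft; apply/geometric_simplexE => v vt.
    by apply/eqP; apply: contrapT => /negP fv; apply: h; exists v.
  suff : nbhs x (fun y => bary (f y) v != 0).
    apply: filterS => y /= fy /geometric_simplexE /(_ v vt).
    by move/eqP; rewrite (negPf fy).
  by apply: (fcont v x [set r | r != 0]); apply: open_nbhs_nbhs; split => //; exact: open_neq.
have near2 t : \forall y \near x, simplices K t -> geometric_simplex t (bary (f y)) ->
    W t (bary (f y)).
  have [Kt|NKt] := pselect (simplices K t); last exact: nearW.
  by apply: filterS (near1 t Kt) => y h _.
have := @filter_bigI _ _ (fpowerset s) (fun t => [set y | simplices K t ->
  geometric_simplex t (bary (f y)) -> W t (bary (f y))]) (nbhs x) _.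
move=> /(_ _ (fun t _ => near2 t)); apply: filterS => y /(_ (support (f y))).
rewrite /= fpowersetE fs => /(_ isT (simplices_support _)) h.
have fy : geometric_simplex (support (f y)) (bary (f y)).
  exact/geometric_simplex_support/fsubset_refl.
by apply/(WE _ _ (simplices_support (f y)) fy)/h.
Qed.

(* The weak topology makes any set of points with distinct supports closed and
   discrete, hence finite inside a compact set. *)
Lemma compact_finite_support (X : topologicalType) (f : X -> polyhedron R K) :
  compact [set: X] -> continuous f -> exists s, forall x, support (f x) `<=` s.
Proof.
move=> /compact_cover_compact cX fcont.
pose Q : set {fset V} := range (fun x => support (f x)).
have [x0|X0] := pselect (exists x0 : X, True); last first.
  by exists fset0 => x; exfalso; apply: X0; exists x.
have /choice[rep repE] : forall s, exists x, Q s -> support (f x) = s.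
  move=> s; have [[x _ xs]|nQ] := pselect (Q s); first by exists x.
  by have [x _] := x0; exists x.
(* All chosen representatives are removed except the one with support [s]. This set is open because
   a closed simplex contains only finitely many representatives; a finite subcover then bounds the
   number of supports. *)
pose U s : set (polyhedron R K) :=
  [set a | forall s', Q s' -> s' != s -> a <> f (rep s')].
have oU s : open (U s).
  change (polyhedron_open (U s)) => t Kt; pose B s' : set (geometric_simplex t) :=
    [set c | Q s' -> s' != s -> simplex_incl Kt c <> f (rep s')].
  have -> : simplex_incl Kt @^-1` U s = \bigcap_(s' in [set` fpowerset t]) B s'.
    apply/seteqP; split => [c Uc s' _ Qs' s's|c Bc s' Qs' s's E]; first exact: Uc.
    apply: (Bc s') (E) => //=; rewrite fpowersetE -(repE _ Qs') -E.
    by apply/geometric_simplex_support => /=; exact: set_valP.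
  rewrite openE => c Bc; rewrite /interior.
  apply: (@filter_bigI _ _ (fpowerset t) B (nbhs c)) => s' s't.
  have [Qs'|nQ] := pselect (Q s'); last by apply: (@filterE _ (nbhs c)) => ? /nQ.
  have [s's|s's] := boolP (s' != s); last first.
    by apply: (@filterE _ (nbhs c)) => ? _ neq; case/negP: s's.
  have [v cv] : exists v, set_val c v != bary (f (rep s')) v.
    apply: contrapT => h; apply: (Bc s') => //; apply: bary_inj => v /=.
    by apply/eqP; apply: contrapT => /negP cv; apply: h; exists v.
  suff : nbhs c (fun c' => set_val c' v != bary (f (rep s')) v).
    by apply: filterS => c' /= c'v _ _ E; move: c'v; rewrite -E eqxx.
  apply: (@simplex_coord_continuous t v c [set r | r != bary (f (rep s')) v]).
  by apply: open_nbhs_nbhs; split => //; exact: open_neq.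
have [s _|x _|D _ XD] := cX _ Q (fun s => f @^-1` U s).
- by apply: open_comp => // x _; exact: fcont.
- exists (support (f x)); first by exists x.
  by move=> s' Qs' s's fx; move: s's; rewrite fx repE// eqxx.
exists (\bigcup_(s <- D) s) => x.
have Qx : Q (support (f x)) by exists x.
have [//|s /= sD Us] := XD (rep (support (f x))).
have E : support (f x) = s.
  by apply/eqP; apply: contrapT => /negP neq; exact: Us neq _.
by rewrite E; apply: bigfcup_sup.
Qed.

End polyhedra.

(** * Joins and subadditivity *)

Section join.
Context {R : realType} {V W : choiceType}.
Variables (K : simplicial_complex V) (L : simplicial_complex W).
Local Open Scope fset_scope.

Definition join_fset (s : {fset V}) (t : {fset W}) : {fset V + W} :=
  (@inl V W) @` s `|` (@inr V W) @` t.

Lemma in_join_inl s t v : (inl v \in join_fset s t) = (v \in s).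
Proof.
rewrite inE mem_imfset; last by move=> ? ? [].
by rewrite orbC; case: imfsetP => // -[].
Qed.

Lemma in_join_inr s t w : (inr w \in join_fset s t) = (w \in t).
Proof.
rewrite inE orbC mem_imfset; last by move=> ? ? [].
by rewrite orbC; case: imfsetP => // -[].
Qed.

Lemma perm_join_fset s t :
  perm_eq (join_fset s t) ([seq inl v | v <- s] ++ [seq inr w | w <- t]).
Proof.
apply: uniq_perm => [||[v|w]]; first exact: fset_uniq.
- rewrite cat_uniq !map_inj_uniq ?fset_uniq/=; [|by move=> ? ? []..].
  by rewrite andbT; apply/hasPn => _ /mapP[w _ ->]; apply/mapP => -[].
- rewrite mem_cat in_join_inl mem_map; last by move=> ? ? [].
  by rewrite [X in _ || X](_ : _ = false) ?orbF//; apply/mapP => -[].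
- rewrite mem_cat in_join_inr mem_map; last by move=> ? ? [].
  by rewrite [X in X || _](_ : _ = false)//; apply/mapP => -[].
Qed.

Lemma card_join_fset s t : #|` join_fset s t| = (#|` s| + #|` t|)%N.
Proof. by rewrite (perm_size (perm_join_fset s t)) size_cat !size_map. Qed.

Lemma join_fset_sub s t s' t' :
  s `<=` s' -> t `<=` t' -> join_fset s t `<=` join_fset s' t'.
Proof.
move=> /fsubsetP ss' /fsubsetP tt'; apply/fsubsetP => -[v|w].
  by rewrite !in_join_inl => /ss'.
by rewrite !in_join_inr => /tt'.
Qed.

Definition join_simplices : set {fset V + W} := [set u | u != fset0 /\
  exists s t, [/\ simplices K s, simplices L t & u `<=` join_fset s t]].

Lemma join_simplices_neq0 u : join_simplices u -> u != fset0.
Proof. by case. Qed.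

Lemma join_simplices_sub u u' : join_simplices u -> u' `<=` u -> u' != fset0 ->
  join_simplices u'.
Proof.
case=> _ [s [t [Ks Lt ust]]] u'u u'0; split => //.
by exists s, t; split => //; exact: fsubset_trans ust.
Qed.

Definition join : simplicial_complex (V + W)%type :=
  SimplicialComplex join_simplices_neq0 join_simplices_sub.

Implicit Types (a : polyhedron R K) (b : polyhedron R L).

(** The midpoint of the segment of the join from [a] to [b], from which both ends can be
    recovered. *)
Definition join_bary a b : {ptws (V + W)%type -> R} :=
  fun x => match x with inl v => bary a v / 2 | inr w => bary b w / 2 end.

Lemma join_baryP a b :
  exists2 u, simplices join u & geometric_simplex u (join_bary a b).
Proof.
exists (join_fset (support a) (support b)).
  split; last by exists (support a), (support b); split => //; exact: simplices_support.
  have /fset0Pn[v va] := simplices_neq0 (simplices_support a).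
  by apply/fset0Pn; exists (inl v); rewrite in_join_inl.
split=> [[v|w]|[v|w]|].
- by rewrite divr_ge0// bary_ge0.
- by rewrite divr_ge0// bary_ge0.
- by rewrite in_join_inl mem_support negbK /= => /eqP ->; rewrite mul0r.
- by rewrite in_join_inr mem_support negbK /= => /eqP ->; rewrite mul0r.
rewrite (perm_big _ (perm_join_fset _ _)) big_cat !big_map /=.
by rewrite -!mulr_suml !sum_support ?fsubset_refl// -splitr.
Qed.

Definition join_point a b : polyhedron R join := Polyhedron (join_baryP a b).

Lemma support_join a b :
  support (join_point a b) = join_fset (support a) (support b).
Proof.
apply/fsetP => -[v|w]; rewrite mem_support ?in_join_inl ?in_join_inr mem_support /=.
  by rewrite mulf_eq0 invr_eq0 pnatr_eq0 orbF.
by rewrite mulf_eq0 invr_eq0 pnatr_eq0 orbF.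
Qed.

Lemma join_point_inj a b a' b' :
  join_point a b = join_point a' b' -> a = a' /\ b = b'.
Proof.
move=> /(congr1 (@bary _ _ _)) /= E.
have half (x y : R) : x / 2 = y / 2 -> x = y.
  by move/mulIf; apply; rewrite invr_eq0 pnatr_eq0.
split; apply: bary_inj => x; apply: half.
  exact: (congr1 (fun h => h (inl x)) E).
exact: (congr1 (fun h => h (inr x)) E).
Qed.

(** A simplex around the join point lies in the join of a simplex around [a] and one around [b];
    vertex numbers add up, so dimensions add up to one more. *)
Lemma local_dim_join a b :
  (local_dim (join_point a b) <= local_dim a + local_dim b + 1)%E.
Proof.
apply: ge_ereal_sup => _ [u [[_ [s [t [Ks Lt ust]]]] /geometric_simplex_support abu] <-].
rewrite support_join in abu.
have /fsubsetP abst := fsubset_trans abu ust.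
have as_ : support a `<=` s.
  by apply/fsubsetP => v; rewrite -(in_join_inl _ (support b)) => /abst; rewrite in_join_inl.
have bt : support b `<=` t.
  by apply/fsubsetP => w; rewrite -(in_join_inr (support a)) => /abst; rewrite in_join_inr.
apply: le_trans (leeD (leeD (local_dim_ge Ks as_) (local_dim_ge Lt bt)) (lexx _)).
rewrite -!EFinD lee_fin -natrD natr1 ler_nat.
have := fsubset_leq_card ust; rewrite card_join_fset.
have := simplices_neq0 Ks; have := simplices_neq0 Lt.
rewrite -!cardfs_gt0.
move: #|` s| #|` t| #|` u| => [//|m] [//|k] [//|l] _ _ /=.
by rewrite addSn addnS ltnS.
Qed.

(** By compactness both maps have their supports in finite sets, where continuity can be tested on
    each barycentric coordinate. *)
Lemma join_continuous (X : topologicalType) (f : X -> polyhedron R K)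
    (g : X -> polyhedron R L) : compact [set: X] -> continuous f -> continuous g ->
  continuous (fun x => join_point (f x) (g x)).
Proof.
move=> cX cf cg.
have [s fs] := compact_finite_support cX cf.
have [t gt] := compact_finite_support cX cg.
apply: (@polyhedron_continuous _ _ _ _ _ (join_fset s t)) => [x|[v|w] x].
- by rewrite support_join join_fset_sub.
- apply: cvgMl; apply: (@continuous_comp _ _ _ f (fun a => bary a v)).
    exact: cf.
  exact: bary_continuous.
- apply: cvgMl; apply: (@continuous_comp _ _ _ g (fun b => bary b w)).
    exact: cg.
  exact: bary_continuous.
Qed.

End join.

(** * Fekete's lemma *)

Section fekete.
Context {R : realType}.

(** The limit is the infimum of the ratios over positive indices. *)
Lemma fekete (b : nat -> R) (C : R) : (forall n m, b (n + m)%N <= b n + b m) ->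
  (forall n, C * n%:R <= b n) -> cvgn (fun n => b n / n%:R).
Proof.
move=> bD bC; pose E := [set b n.+1 / n.+1%:R | n in [set: nat]].
have infE : has_inf E.
  split; first by exists (b 1%N / 1), 0%N.
  exists C => _ [n _ <-]; rewrite ler_pdivlMr ?ltr0n//; exact: bC.
apply/cvg_ex; exists (inf E).
apply/cvgrPdist_le => e e0.
have [_ [k _ <-] kE] := @inf_adherent _ E (e / 2) (divr_gt0 e0 (ltr0n _ 2)) infE.
set c := b k.+1 / k.+1%:R in kE.
(* Subtracting the linear part keeps subadditivity and makes [b'] vanish at [k.+1], so [b'] is
   bounded above by its values on the remainders modulo [k.+1]. *)
pose b' n := b n - n%:R * c.
have b'D n m : b' (n + m)%N <= b' n + b' m.
  by rewrite /b' natrD mulrDl opprD addrACA lerD2r.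
have b'k : b' k.+1 = 0 by rewrite /b' /c mulrCA divff ?mulr1 ?subrr// pnatr_eq0.
have b'mul q r : b' (q * k.+1 + r)%N <= b' r.
  elim: q => [|q IHq]; first by rewrite mul0n.
  by rewrite mulSn -addnA (le_trans (b'D _ _))// b'k add0r.
pose B := \sum_(r < k.+1) `|b' r|.
have B0 : 0 <= B by apply: sumr_ge0.
have b'B n : b' n <= B.
  rewrite (divn_eq n k.+1) (le_trans (b'mul _ _))//.
  have rk : (n %% k.+1 < k.+1)%N by rewrite ltn_mod.
  rewrite /B (bigD1 (Ordinal rk)) //= (le_trans (ler_norm _))// lerDl.
  by apply: sumr_ge0.
(* From this index on, [B / n] is at most [e / 2]. *)
exists (Num.bound (B / (e / 2))).+1 => // -[//|n] /= hn.
have n0 : 0 < n.+1%:R :> R by rewrite ltr0n.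
have Ebn : inf E <= b n.+1 / n.+1%:R by apply: ge_inf; [exact: infE.2|exists n].
rewrite distrC ger0_norm ?subr_ge0// lerBlDl.
have bE : b n.+1 / n.+1%:R <= c + B / n.+1%:R.
  rewrite -[c](mulfK (lt0r_neq0 n0)) -mulrDl ler_pM2r ?invr_gt0//.
  by rewrite -lerBlDl mulrC; exact: b'B.
rewrite (le_trans bE)// [e]splitr addrA lerD ?(ltW kE)//.
rewrite ler_pdivrMr// -ler_pdivrMl ?divr_gt0// mulrC.
apply/ltW; apply: lt_le_trans (archi_boundP _) _.
  by rewrite divr_ge0// ltW// divr_gt0.
by rewrite ler_nat ltnW.
Qed.

End fekete.

(** * Bowen metrics and Birkhoff sums *)

Section bowen_metric.
Context {R : realType} {Y : topologicalType} (T : Y -> Y) (d : Y -> Y -> R).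

Lemma bowen_metric_le N x y c : 0 <= c ->
  (forall n, (n < N)%N -> d (iter n T x) (iter n T y) <= c) ->
  bowen_metric T d N x y <= c.
Proof.
move=> c0 dc; rewrite /bowen_metric big_nat.
by apply: (big_ind (fun z => z <= c)) => // a b ac bc; rewrite ge_max ac.
Qed.

Lemma le_bowen_metric N n x y : (n < N)%N ->
  d (iter n T x) (iter n T y) <= bowen_metric T d N x y.
Proof.
move=> nN; rewrite /bowen_metric.
apply: (@le_bigmax_seq _ R _ _ 0 n xpredT (fun n => d (iter n T x) (iter n T y))) => //.
by rewrite mem_index_iota.
Qed.

Lemma bowen_metric_ge0 N x y : 0 <= bowen_metric T d N x y.
Proof. exact: bigmax_ge_id. Qed.

Lemma bowen_metric_add_le N M x y : bowen_metric T d (N + M) x y <=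
  Num.max (bowen_metric T d N x y)
    (bowen_metric T d M (iter N T x) (iter N T y)).
Proof.
apply: bowen_metric_le => [|n nNM]; first by rewrite le_max bowen_metric_ge0.
rewrite le_max; case: (ltnP n N) => [/le_bowen_metric ->//|Nn].
apply/orP; right; rewrite -(subnK Nn) !iterD.
by apply: le_bowen_metric; rewrite ltn_subLR.
Qed.

Lemma birkhoff_sum_add (phi : Y -> R) N M x : birkhoff_sum T phi (N + M) x =
  birkhoff_sum T phi N x + birkhoff_sum T phi M (iter N T x).
Proof.
rewrite /birkhoff_sum (big_cat_nat (n := N)) ?leq_addr//=; congr (_ + _).
rewrite -{1}[N]add0n big_addn addKn; apply: eq_bigr => n _.
by rewrite iterD.
Qed.

End bowen_metric.

Lemma iter_continuous (Y : topologicalType) (T : Y -> Y) n :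
  continuous T -> continuous (iter n T).
Proof.
move=> cT; elim: n => [|n IHn] x /=; first exact: cvg_id.
by apply: (@continuous_comp _ _ _ (iter n T) T); [exact: IHn|exact: cT].
Qed.

(** * Width dimension and its growth rate *)

Section widim.
Context {R : realType} {Y : topologicalType}.
Variables (T : Y -> Y) (phi : Y -> R) (d : Y -> Y -> R).

Lemma Widim_le eps (rho : Y -> Y -> R) (psi : Y -> R) (w : \bar R)
    (V : choiceType) (K : simplicial_complex V) (f : Y -> polyhedron R K) :
  eps_embedding rho eps f -> (forall y, local_dim (f y) + (psi y)%:E <= w)%E ->
  (Widim eps rho psi <= w)%E.
Proof.
move=> femb fw; apply: le_trans (ereal_inf_lbound _) _.
  by exists V, K, f; split; [exact: femb|reflexivity].
by apply: ge_ereal_sup => _ [y _ <-].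
Qed.

Lemma Widim_ge eps (rho : Y -> Y -> R) (psi : Y -> R) (w : \bar R) :
  (forall (V : choiceType) (K : simplicial_complex V) (f : Y -> polyhedron R K),
    eps_embedding rho eps f -> exists y, w <= local_dim (f y) + (psi y)%:E)%E ->
  (w <= Widim eps rho psi)%E.
Proof.
move=> H; apply: le_ereal_inf_tmp => _ [V [K [f [femb ->]]]].
have [y /le_trans] := H V K f femb; apply.
by apply: ereal_sup_ubound; exists y.
Qed.

Hypothesis cY : compact [set: Y].
Hypothesis cT : continuous T.

(** An embedding for the first [N] steps is joined with one for the next [M] steps, precomposed with
    the [N]-th iterate. A fibre of the join lies in a fibre of each; the 1 is the dimension cost of
    joining. *)
Lemma Widim_join eps N M (v w : R) :
  (Widim eps (bowen_metric T d N) (birkhoff_sum T phi N) < v%:E)%E ->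
  (Widim eps (bowen_metric T d M) (birkhoff_sum T phi M) < w%:E)%E ->
  (Widim eps (bowen_metric T d (N + M)) (birkhoff_sum T phi (N + M)) <=
     (v + w + 1)%:E)%E.
Proof.
move=> /ereal_inf_lt[_ [V [K [f [[cf femb] ->]]]] fv].
move=> /ereal_inf_lt[_ [W [L [g [[cg gemb] ->]]]] gw].
pose g' y := g (iter N T y).
have cg' : continuous g'.
  move=> y; apply: (@continuous_comp _ _ _ (iter N T) g); last exact: cg.
  exact: iter_continuous.
apply: (@Widim_le _ _ _ _ _ _ (fun y => join_point (f y) (g' y))).
  split; first exact: join_continuous.
  move=> z.
  have [[y0 y0z]|nz] := pselect (exists y0, join_point (f y0) (g' y0) = z); last first.
    (* An empty fibre has diameter [-oo]. *)
    rewrite /diam (_ : [set _ | _ in _ & _ in _] = set0) ?ereal_sup0 ?ltNyr//.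
    by apply/seteqP; split => [t [y yz]|]//; exfalso; apply: nz; exists y.
  apply: (@le_lt_trans _ _ (maxe (diam (bowen_metric T d N) (f @^-1` [set f y0]))
    (diam (bowen_metric T d M) (g @^-1` [set g' y0])))); last first.
    by rewrite gt_max femb gemb.
  apply: ge_ereal_sup => _ [x /= xz [y /= yz <-]].
  move: xz yz; rewrite -y0z => /join_point_inj[xf xg] /join_point_inj[yf yg].
  apply: (@le_trans _ _ (Num.max (bowen_metric T d N x y)
    (bowen_metric T d M (iter N T x) (iter N T y)))%:E).
    by rewrite lee_fin bowen_metric_add_le.
  rewrite EFin_max ge_max !le_max; apply/andP; split; apply/orP; [left|right].
    by apply: ereal_sup_ubound; exists x => //; exists y.
  by apply: ereal_sup_ubound; exists (iter N T x) => //; exists (iter N T y).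
move=> y; rewrite birkhoff_sum_add EFinD.
apply: (@le_trans _ _ (local_dim (f y) + local_dim (g' y) + 1 +
  ((birkhoff_sum T phi N y)%:E + (birkhoff_sum T phi M (iter N T y))%:E)))%E.
  by rewrite leeD2r// local_dim_join.
rewrite addeAC addeACA.
rewrite EFinD EFinD; apply: leeD => //; apply: leeD.
  by apply: le_trans (ltW fv); apply: ereal_sup_ubound; exists y.
by apply: le_trans (ltW gw); apply: ereal_sup_ubound; exists (iter N T y).
Qed.

(** The sequence [w N + 1] is subadditive, and the added [1 / N] tends to 0. *)
Lemma Widim_rate_cvg eps (C : R) (w : nat -> R) :
  (forall N, Widim eps (bowen_metric T d N) (birkhoff_sum T phi N) = (w N)%:E) ->
  (forall N, C * N%:R <= w N) -> cvgn (fun N => w N / N%:R).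
Proof.
move=> wE wC.
have wD N M : w (N + M)%N <= w N + w M + 1.
  (* The infimum defining [Widim] need not be attained, so each of the two widths is given a slack
     of [e / 2]. *)
  apply/ler_addgt0Pl => e e0; rewrite -lee_fin -wE.
  have -> : e + (w N + w M + 1) = (w N + e / 2) + (w M + e / 2) + 1.
    by field.
  by apply: Widim_join; rewrite wE lte_fin ltrDl divr_gt0.
have := @fekete _ (fun N => w N + 1) C.
have h1 n m : w (n + m)%N + 1 <= w n + 1 + (w m + 1).
  by rewrite addrACA addrA lerD2r.
have h2 n : C * n%:R <= w n + 1 by rewrite (le_trans (wC n))// lerDl.
move=> /(_ h1 h2) cw.
have -> : (fun N => w N / N%:R) = (fun N => (w N + 1) / N%:R - N%:R^-1).
  by apply/funext => N; rewrite mulrDl mul1r addrK.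
apply: is_cvgB => //; apply: (cvgP (0 : R)).
by rewrite -cvg_shiftS; exact: cvg_harmonic.
Qed.

End widim.

(** * The full shift *)

Section compatible_metric.
Context {R : realType} {Y : topologicalType}.
Variable d : Y -> Y -> R.
Hypothesis dP : compatible_metric d.

Lemma dist_cauchy x y x' y' : `|d x y - d x' y'| <= d x x' + d y y'.
Proof.
have tri := dist_triangle dP; have sym := dist_sym dP.
rewrite ler_norml; apply/andP; split.
  rewrite lerBrDl; have := tri x' x y'; have := tri x y y'.
  by rewrite (sym x' x); lra.
have := tri x x' y; have := tri x' y' y.
by rewrite (sym y' y); lra.
Qed.

Lemma dist_continuous : continuous (fun z : Y * Y => d z.1 z.2).
Proof.
move=> z; apply/cvgrPdist_lt => e e0.
have near_ball (x : Y) : nbhs x [set y | d x y < e / 2].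
  by apply/(dist_nbhs dP); exists (e / 2) => //; exact: divr_gt0.
have nz : nbhs z [set w : Y * Y | d z.1 w.1 < e / 2 /\ d z.2 w.2 < e / 2].
  by exists ([set y | d z.1 y < e / 2], [set y | d z.2 y < e / 2]);
    [split; exact: near_ball|].
apply: filterS nz => w [w1 w2]; apply: le_lt_trans (dist_cauchy _ _ _ _) _.
by rewrite [e]splitr ltrD.
Qed.

Lemma bowen_metric_continuous (T : Y -> Y) N : continuous T ->
  continuous (fun z : Y * Y => bowen_metric T d N z.1 z.2).
Proof.
move=> cT; rewrite /bowen_metric; elim: (index_iota 0 N) => [|n s IHs].
  under eq_fun do rewrite big_nil.
  exact: cst_continuous.
under eq_fun do rewrite big_cons.
apply: max_fun_continuous => // z.
apply: (@continuous_comp _ _ _ (fun z : Y * Y => (iter n T z.1, iter n T z.2))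
  (fun z : Y * Y => d z.1 z.2)); last exact: dist_continuous.
apply: cvg_pair => /=.
  by apply: (@continuous_comp _ _ _ fst (iter n T)); [exact: cvg_fst|exact: iter_continuous].
by apply: (@continuous_comp _ _ _ snd (iter n T)); [exact: cvg_snd|exact: iter_continuous].
Qed.

End compatible_metric.

Section full_shift.
Context {R : realType} {D : nat}.
Local Notation Y := (cube_sequences R D).
Implicit Types x y : Y.

Definition coord k x : 'rV[R]_D := set_val (x k).

Lemma coordP k x : unit_cube (coord k x). Proof. exact: set_valP. Qed.

Lemma coord_inj x y : (forall k, coord k x = coord k y) -> x = y.
Proof. by move=> xy; apply/funext => k; apply/val_inj/xy. Qed.

Lemma coord_continuous k : continuous (coord k).
Proof.
move=> x.
apply: (@continuous_comp _ _ _ (fun z : Y => z k) (set_val : cube R D -> _) x).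
  exact: (@proj_continuous nat (fun=> cube R D) k x).
exact: initial_continuous.
Qed.

Lemma left_shift_iter n x k : iter n (@left_shift R D) x k = x (n + k)%N.
Proof. by elim: n k => //= n IHn k; rewrite /left_shift IHn addnS. Qed.

Lemma coord_iter n k x : coord k (iter n (@left_shift R D) x) = coord (n + k) x.
Proof. by rewrite /coord left_shift_iter. Qed.

Lemma cube_sequences_continuous (X : topologicalType) (f : X -> Y) :
  (forall k, continuous (fun t => coord k (f t))) -> continuous f.
Proof.
move=> fcont; apply: (@ptws_continuous X (cube R D) nat f) => k t A.
rewrite nbhsE => -[_ [[B oB <-] Bx] BA].
suff : nbhs t (fun t => B (coord k (f t))) by apply: filterS => t' Bt; exact: BA.
by apply: fcont; apply: open_nbhs_nbhs; split.
Qed.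

Lemma left_shift_continuous : continuous (@left_shift R D).
Proof.
apply: cube_sequences_continuous => k x.
exact: (@coord_continuous k.+1 x).
Qed.

Lemma cube_sequences_compact : compact [set: Y].
Proof.
have cc : compact [set: cube R D].
  apply: compact_set_type.
  rewrite (_ : @unit_cube R D = [set v : 'rV[R]_D | forall i, `[0, 1]%classic (v ord0 i)]).
    exact: (@rV_compact R D (fun=> `[0, 1]%classic) (fun=> @segment_compact R 0 1)).
  by apply/seteqP; split => v vP i; have := vP i; rewrite /= in_itv.
rewrite (_ : [set: Y] = [set f | forall k, [set: cube R D] (f k)]).
  exact: (@tychonoff nat (fun=> cube R D) (fun=> setT)).
by apply/seteqP; split.
Qed.

Lemma cube_sequences2_compact : compact [set: Y * Y].
Proof. by rewrite -setXTT; apply: compact_setX; exact: cube_sequences_compact. Qed.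

Lemma coord_dist_continuous k :
  continuous (fun z : Y * Y => `|coord k z.1 - coord k z.2|).
Proof.
move=> z; apply: continuous_comp; last exact: norm_continuous.
apply: continuousB.
  by apply: (@continuous_comp _ _ _ fst (coord k)); [exact: cvg_fst|exact: coord_continuous].
by apply: (@continuous_comp _ _ _ snd (coord k)); [exact: cvg_snd|exact: coord_continuous].
Qed.

(** On the compact set where [g] is at least [e] the two points differ, so one of finitely many
    coordinates differs by more than a uniform [r]. *)
Lemma modulus_of_continuity (g : Y * Y -> R) e : continuous g ->
  (forall x, g (x, x) = 0) -> 0 < e ->
  exists L r, 0 < r /\ forall x y,
    (forall k, (k < L)%N -> `|coord k x - coord k y| <= r) -> g (x, y) < e.
Proof.
move=> cg g0 e0.
have cC : compact [set z | e <= g z].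
  apply: (subclosed_compact _ cube_sequences2_compact) => //.
  by apply: (@closed_comp _ _ g [set s | e <= s]) => [z _|]; [exact: cg|exact: closed_ge].
have [[x y] /= exy|S [r [r0 Sr]]] := compact_positive cC coord_dist_continuous.
  apply: contrapT => /forallNP H; have xy : x = y.
    apply: coord_inj => k; apply/eqP; rewrite -subr_eq0 -normr_eq0.
    by have /negP := H k; rewrite normr_gt0 negbK => /eqP ->; rewrite normr0.
  by move: exy; rewrite xy g0 leNgt e0.
exists (\max_(k <- S) k).+1, r; split => // x y xy; rewrite ltNge; apply/negP => exy.
have [k kS] := Sr _ exy; rewrite ltNge xy// ltnS.
exact: (@leq_bigmax_seq _ _ xpredT id).
Qed.

Variable d : Y -> Y -> R.
Hypothesis dP : compatible_metric d.

(** A positive continuous function on a compact set has a positive lower bound. Coordinate 0 is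
    enough, since the shift brings every coordinate there. *)
Lemma dist_coord0 r : 0 < r ->
  exists2 e, 0 < e & forall x y, r <= `|coord 0 x - coord 0 y| -> e < d x y.
Proof.
move=> r0.
have cC : compact [set z : Y * Y | r <= `|coord 0 z.1 - coord 0 z.2|].
  apply: (subclosed_compact _ cube_sequences2_compact) => //.
  apply: (@closed_comp _ _ _ [set s | r <= s]) => [z _|]; last exact: closed_ge.
  exact: coord_dist_continuous.
have [[x y] /= rxy|S [e [e0 Se]]] :=
    @compact_positive _ _ unit _ (fun _ z => d z.1 z.2) cC (fun=> dist_continuous dP).
  exists tt; rewrite lt_neqAle (dist_ge0 dP) andbT eq_sym.
  apply/eqP => /(dist_eq0 dP) xy; move: rxy.
  by rewrite xy subrr normr0 leNgt r0.
by exists e => // x y /(Se (x, y))[].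
Qed.

End full_shift.

(** * Upper bound *)

Definition full_complex (V : choiceType) (s0 : {fset V}) : simplicial_complex V.
refine (@SimplicialComplex V [set s | s != fset0 /\ s `<=` s0]%fset _ _).
  by move=> s [].
by move=> s t [_ ss0] ts t0; split => //; exact: fsubset_trans ss0.
Defined.

Section flat_coordinates.
Context {R : realType} {D : nat}.
Hypothesis D_gt0 : (0 < D)%N.
Local Notation Y := (cube_sequences R D).
Implicit Types x y : Y.

(** All real coordinates listed in one sequence, [D] of them for each time. *)
Definition flat (j : nat) x : R := coord (j %/ D) x ord0 (Ordinal (ltn_pmod j D_gt0)).

Lemma flat_itv j x : 0 <= flat j x <= 1.
Proof. exact: coordP. Qed.

Lemma flat_continuous j : continuous (flat j).
Proof.
move=> x; apply: (@continuous_comp _ _ _ (coord (j %/ D))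
  (fun v : 'rV[R]_D => v ord0 (Ordinal (ltn_pmod j D_gt0)))).
  exact: coord_continuous.
exact: matrix_normedtype.coord_continuous.
Qed.

Lemma coord_flat k (i : 'I_D) x : coord k x ord0 i = flat (k * D + i) x.
Proof.
rewrite /flat divnMDl// divn_small// addn0; congr (coord k x ord0 _).
by apply: val_inj; rewrite /= modnMDl modn_small.
Qed.

Lemma eq_coord_flat m x y : (forall j, (j < m * D)%N -> flat j x = flat j y) ->
  forall k, (k < m)%N -> coord k x = coord k y.
Proof.
move=> xy k km; apply/rowP => i; rewrite !coord_flat; apply: xy.
by apply: (@leq_trans (k.+1 * D)); rewrite ?leq_mul2r ?km ?orbT// mulSn addnC ltn_add2r.
Qed.

End flat_coordinates.

(** * Embedding a cube in a simplex of the same dimension *)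

Section simplex_map.
Context {R : realType} {X : topologicalType} (n : nat) (c : nat -> X -> R).
Hypothesis c_itv : forall j x, 0 <= c j x <= 1.
Hypothesis c_continuous : forall j, continuous (c j).

Definition simplex_vertices : {fset nat} := [fset v in iota 0 n.+1]%fset.

Lemma mem_simplex_vertices v : (v \in simplex_vertices) = (v <= n)%N.
Proof. by rewrite in_fset mem_iota. Qed.

Lemma perm_simplex_vertices : perm_eq simplex_vertices (index_iota 0 n.+1).
Proof.
apply: uniq_perm; [exact: fset_uniq|exact: iota_uniq|move=> v].
by rewrite mem_simplex_vertices mem_index_iota.
Qed.

(** Dividing by [n + 1] keeps the sum of the first [n] coordinates below 1; the vertex [n] takes the
    remaining mass. *)
Definition simplex_bary x : {ptws nat -> R} := fun v =>
  if (v < n)%N then c v x / n.+1%:R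
  else if v == n then 1 - \sum_(0 <= j < n) c j x / n.+1%:R else 0.

Lemma simplex_baryP x : exists2 s, simplices (full_complex simplex_vertices) s &
  geometric_simplex s (simplex_bary x).
Proof.
exists simplex_vertices.
  split; last exact: fsubset_refl.
  by apply/fset0Pn; exists 0%N; rewrite mem_simplex_vertices.
have n0 : 0 < n.+1%:R :> R by rewrite ltr0n.
split=> [v|v|].
- rewrite /simplex_bary; case: ltnP => [_|_].
    by rewrite divr_ge0 ?ler0n//; case/andP: (c_itv v x).
  case: eqP => // _; rewrite subr_ge0 -mulr_suml ler_pdivrMr// mul1r.
  apply: (@le_trans _ _ (\sum_(0 <= j < n) 1)).
    by apply: ler_sum => j _; case/andP: (c_itv j x).
  by rewrite sumr_const_nat subn0 ler_nat.
- rewrite mem_simplex_vertices -ltnNge /simplex_bary => nv.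
  by rewrite ltnNge ltnW//= gtn_eqF.
rewrite (perm_big _ perm_simplex_vertices).
rewrite big_nat_recr//= {2}/simplex_bary ltnn eqxx.
rewrite [X in X + _](_ : _ = \sum_(0 <= j < n) c j x / n.+1%:R).
  by rewrite addrC subrK.
by rewrite !big_nat; apply: eq_bigr => j /= jn; rewrite /simplex_bary jn.
Qed.

Definition simplex_map x : polyhedron R (full_complex simplex_vertices) :=
  Polyhedron (simplex_baryP x).

Lemma support_simplex_map x : (support (simplex_map x) `<=` simplex_vertices)%fset.
Proof.
apply/fsubsetP => v; rewrite mem_support mem_simplex_vertices /= /simplex_bary.
by case: ltngtP => //=; rewrite eqxx.
Qed.

Lemma simplex_map_continuous : continuous simplex_map.
Proof.
apply: (polyhedron_continuous support_simplex_map) => v.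
rewrite /= /simplex_bary; case: ltnP => _.
  by move=> x; apply: cvgMl; exact: c_continuous.
case: eqP => _ x; last exact: cvg_cst.
apply: cvgB; first exact: cvg_cst.
apply: (@cvg_big _ _ +%R) => [|j _]; last by apply: cvgMl; exact: c_continuous.
exact: add_continuous.
Qed.

Lemma simplex_map_inj x y j : simplex_map x = simplex_map y -> (j < n)%N ->
  c j x = c j y.
Proof.
move=> /(congr1 (fun a => bary a j)) /= + jn; rewrite /simplex_bary jn.
by move/mulIf; apply; rewrite invr_eq0 pnatr_eq0.
Qed.

Lemma local_dim_simplex_map x : (local_dim (simplex_map x) <= n%:R%:E)%E.
Proof.
apply: ge_ereal_sup => _ [s [[_ /fsubset_leq_card sn] _] <-].
move: sn; rewrite (perm_size perm_simplex_vertices) size_iota subn0 => sn.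
by rewrite lee_fin ler_nat; case: #|` s|%fset sn.
Qed.

End simplex_map.

Section upper_bound.
Context {R : realType} {D : nat}.
Hypothesis D_gt0 : (0 < D)%N.
Local Notation Y := (cube_sequences R D).
Variables (phi : Y -> R) (d : Y -> Y -> R).
Hypothesis dP : compatible_metric d.

(** Agreement in the first [L] coordinates forces distance below [eps / 2], so agreement in the
    first [N + L] does it for [N] iterates. [L] depends on [eps] but not on [N]. *)
Lemma Widim_upper_bound eps : 0 < eps -> exists L, forall N (a : R),
  (forall x, birkhoff_sum (@left_shift R D) phi N x <= a) ->
  (Widim eps (bowen_metric (@left_shift R D) d N)
     (birkhoff_sum (@left_shift R D) phi N) <= (((N + L) * D)%:R + a)%:E)%E.
Proof.
move=> eps0; have eps20 : 0 < eps / 2 by exact: divr_gt0.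
have [x|L [r [r0 Lr]]] := modulus_of_continuity (dist_continuous dP) _ eps20.
  exact/(dist_eq0 dP).
exists L => N a phia.
pose n := ((N + L) * D)%N.
pose f := @simplex_map R Y n (flat D_gt0) (flat_itv D_gt0).
apply: (@Widim_le _ _ _ _ _ _ _ _ f); last first.
  move=> y; rewrite EFinD; apply: leeD; last by rewrite lee_fin.
  exact: local_dim_simplex_map.
split; first exact/simplex_map_continuous/flat_continuous.
(* Pointwise bounds give only a weak inequality for the supremum; using [eps / 2] makes the diameter
   strictly smaller than [eps]. *)
move=> z; apply: (@le_lt_trans _ _ (eps / 2)%:E); last first.
  by rewrite lte_fin ltr_pdivrMr// ltr_pMr// ltr1n.
apply: ge_ereal_sup => _ [x /= xz [y /= yz <-]].
rewrite lee_fin; apply: bowen_metric_le; first exact: ltW.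
move=> k kN; apply/ltW/Lr => l lL; rewrite !coord_iter.
rewrite (@eq_coord_flat _ _ D_gt0 (N + L) x y) ?subrr ?normr0 ?(ltW r0)//.
  by move=> j; apply: (simplex_map_inj (etrans xz (esym yz))).
by rewrite (leq_ltn_trans (leq_add (ltnW kN) (leqnn l)))// ltn_add2l.
Qed.

End upper_bound.

(** * Lower bound *)

Lemma norm_intr_lt1 (R : realType) (z : int) : `|z%:~R : R| < 1 -> z = 0.
Proof.
rewrite -intr_norm -[1]/(1%:~R) ltr_int => z1; apply/eqP.
by rewrite -absz_eq0 -leqn0 -ltnS -ltz_nat abszE.
Qed.

(** No integer lies within [e] of [a], so none separates [a] from [b]. *)
Lemma eq_floor (R : realType) (a b e : R) :
  (forall z : int, e < `|a - z%:~R|) -> `|a - b| < e -> Num.floor a = Num.floor b.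
Proof.
move=> az ab; apply/esym/floor_def.
have /andP[h1 h2] := floor_itv a.
have := az (Num.floor a + 1); have := az (Num.floor a).
rewrite ger0_norm ?subr_ge0 ?(ltW h1)//.
rewrite distrC ger0_norm ?subr_ge0 ?(ltW h2)// => e1 e2.
move: ab; rewrite ltr_norml => /andP[? ?]; apply/andP; split.
  lra.
lra.
Qed.

(** * Phase shifts avoiding the integers *)

Section phases.
Context {R : realType} (n : nat).

(** For [j < n] these are the nonzero multiples of [1/(n+1)] inside [(0,1)]; omitting 0 keeps
    vanishing coordinates away from the integers. *)
Definition phase (j : nat) : R := j.+1%:R / n.+1%:R.

(** A quarter of the spacing of the phases, so that two errors cannot bridge two phases and [n]
    errors add up to less than [1/4]. *)
Definition phase_gap : R := (4 * n.+1%:R)^-1.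

Lemma phase_gap_gt0 : 0 < phase_gap.
Proof. by rewrite invr_gt0 mulr_gt0// ltr0n. Qed.

(* A coordinate is close to an integer after at most one of the [n] phase shifts,
   and after none if it vanishes. So spoiling every phase takes exactly [n]
   nonzero coordinates, one for each; as they sum to 1, the choice of [M]
   excludes this. *)
Lemma good_phase (V : choiceType) (t : V -> R) (s : {fset V}) (M : R) (m : int) :
  M + \sum_(j < n) phase j = m%:~R + 1 / 2 ->
  (#|` s| <= n)%N -> (forall v, v \notin s -> t v = 0) -> \sum_(v <- s) t v = 1 ->
  exists j : 'I_n, forall v (z : int), phase_gap < `|M * t v + phase j - z%:~R|.
Proof.
move=> MP sn t0 t1; apply: contrapT => H.
have n0 : 0 < n.+1%:R :> R by rewrite ltr0n.
have gapE : phase_gap * n.+1%:R = 1 / 4.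
  by rewrite /phase_gap invfM mulfVK ?gt_eqF// div1r.
have /choice[vz vzP] : forall j : 'I_n, exists vz : V * int,
    `|M * t vz.1 + phase j - vz.2%:~R| <= phase_gap.
  move=> j; apply: contrapT => Hj; apply: H; exists j => v z.
  by rewrite ltNge; apply/negP => h; apply: Hj; exists (v, z).
pose v j := (vz j).1; pose z j := (vz j).2.
(* If the coordinate vanished, the phase alone would be near an integer, and [n + 1] would divide
   [j + 1], which is at most [n]. *)
have vs j : v j \in s.
  apply/negPn/negP => /t0 tv0; have := vzP j; rewrite -/(v j) -/(z j) tv0 mulr0 add0r => h.
  have /norm_intr_lt1 : `|((j.+1%:Z - z j * n.+1%:Z)%:~R : R)| < 1.
    rewrite intrB intrM -!pmulrn (_ : _ - _ = (phase j - (z j)%:~R) * n.+1%:R).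
      rewrite normrM (gtr0_norm n0) (le_lt_trans (ler_wpM2r (ltW n0) h))//.
      by rewrite gapE; lra.
    by rewrite mulrBl divfK// gt_eqF.
  move/eqP; rewrite subr_eq0 => /eqP jz.
  have : (n.+1%:Z %| j.+1%:Z)%Z by rewrite jz dvdz_mull.
  rewrite dvdzE !absz_nat.
  by move/(dvdn_leq (ltn0Sn j)); rewrite ltnS leqNgt ltn_ord.
(* One coordinate near integers for two phases would make [i] and [j] congruent modulo [n + 1]. *)
have vinj : injective v.
  move=> i j vij; apply/val_inj => /=.
  have := vzP i; have := vzP j; rewrite -!/(v _) -!/(z _) vij => hj hi.
  have /norm_intr_lt1 : `|((i%:Z - j%:Z - (z i - z j) * n.+1%:Z)%:~R : R)| < 1.
    rewrite (_ : _%:~R = ((M * t (v j) + phase i - (z i)%:~R) -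
        (M * t (v j) + phase j - (z j)%:~R)) * n.+1%:R); last first.
      by rewrite /phase !intrB intrM intrB -!pmulrn -!natr1; field; rewrite natr1 gt_eqF.
    rewrite normrM (gtr0_norm n0).
    apply: (@le_lt_trans _ _ ((phase_gap + phase_gap) * n.+1%:R)).
      rewrite ler_wpM2r ?(ltW n0)// (le_trans (ler_normB _ _))//.
      by rewrite lerD.
    by rewrite mulrDl gapE; lra.
  move/eqP; rewrite subr_eq0 => /eqP ijz.
  have {}ijz : (i%:Z = j%:Z %[mod n.+1%:Z])%Z.
    by apply/eqP; rewrite eqz_mod_dvd ijz dvdz_mull.
  move: ijz; rewrite !modz_nat => -[].
  by rewrite !modn_small// ltnS ltnW.
(* The [n] distinct values of [v] lie in [s], which has at most [n] elements, so they exhaust it and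
   their coordinates sum to 1. *)
have perm : perm_eq [seq v j | j <- enum 'I_n] s.
  have uv : uniq [seq v j | j <- enum 'I_n] by rewrite map_inj_uniq// enum_uniq.
  have sub : {subset [seq v j | j <- enum 'I_n] <= s} by move=> _ /mapP[j _ ->].
  have [|_ eqs] := uniq_min_size uv sub; first by rewrite size_map size_enum_ord.
  by apply: uniq_perm => //; exact: fset_uniq.
have sumt : \sum_(j < n) t (v j) = 1.
  by rewrite -t1 -(perm_big _ perm)/= big_map big_enum.
(* The total error: by the choice of [M] it is half an odd integer, yet it is smaller than [1/2]. *)
pose S := \sum_(j < n) (M * t (v j) + phase j - (z j)%:~R).
have SE : S = m%:~R + 1 / 2 - (\sum_(j < n) z j)%:~R.
  by rewrite /S sumrB big_split/= -mulr_sumr sumt mulr1 MP rmorph_sum.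
have Sle : `|S| < 1 / 2.
  apply: le_lt_trans (ler_norm_sum _ _ _) _.
  apply: (@le_lt_trans _ _ (\sum_(j < n) phase_gap)).
    by apply: ler_sum => j _; exact: vzP.
  rewrite sumr_const card_ord -[_ *+ n]mulr_natr.
  apply: (@le_lt_trans _ _ (phase_gap * n.+1%:R)).
    by rewrite ler_wpM2l ?(ltW phase_gap_gt0)// ler_nat.
  by rewrite gapE; lra.
have /norm_intr_lt1 : `|((2 * (m - \sum_(j < n) z j) + 1)%:~R : R)| < 1.
  rewrite (_ : _%:~R = S * 2).
    by rewrite normrM (ger0_norm (ler0n _ 2)); lra.
  by rewrite SE intrD intrM intrB; field.
move/eqP; rewrite addr_eq0 => /eqP w2.
have : (2 %| (-1 : int))%Z by rewrite -w2 dvdz_mulr.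
by [].
Qed.

End phases.

Lemma scale_continuous (R : realType) (X : topologicalType) (c : R) (h : X -> R) :
  continuous h -> continuous (fun x => c * h x).
Proof. by move=> ch x; apply: cvgMr; exact: ch. Qed.

Lemma increment_continuous (R : realType) (X : topologicalType) (h : X -> R) :
  continuous h -> continuous (fun z : X * X => `|h z.1 - h z.2|).
Proof.
move=> ch z; apply: cvg_norm; apply: cvgB.
  by apply: (@continuous_comp _ _ _ fst h); [exact: cvg_fst|exact: ch].
by apply: (@continuous_comp _ _ _ snd h); [exact: cvg_snd|exact: ch].
Qed.

Lemma sum_increment_continuous (R : realType) (X : topologicalType) (I : Type)
    (s : seq I) (h : I -> X -> R) : (forall i, continuous (h i)) ->
  continuous (fun z : X * X => \sum_(i <- s) `|h i z.1 - h i z.2|).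
Proof.
move=> ch z; apply: (@cvg_big _ _ +%R) => [|i _]; first exact: add_continuous.
exact: increment_continuous.
Qed.

Section lower_bound.
Context {R : realType} {D : nat}.
Hypothesis D_gt0 : (0 < D)%N.
Local Notation Y := (cube_sequences R D).
Local Notation flat := (@flat R D D_gt0).
Local Notation sigma := (@left_shift R D).
Implicit Types x y : Y.

(** Truncation to [[0,1]] makes the inverse of [flat] defined for every real sequence. *)
Definition unflat_row (q : nat -> R) (k : nat) : 'rV[R]_D :=
  \row_i Num.max 0 (Num.min 1 (q (k * D + i)%N)).

Lemma unflat_rowP q k : unflat_row q k \in @unit_cube R D.
Proof.
by rewrite inE => i; rewrite mxE le_max lexx ge_max ler01 ge_min lexx.
Qed.

Definition unflat (q : nat -> R) : Y := 
  fun k => exist (fun v => v \in @unit_cube R D) (unflat_row q k) (unflat_rowP q k).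

Lemma flat_unflat q j : 0 <= q j <= 1 -> flat j (unflat q) = q j.
Proof.
move=> /andP[q0 q1]; rewrite /flat /coord /= mxE /= -divn_eq.
by rewrite min_r// max_r.
Qed.

Lemma le_coord_flat x y r : 0 <= r -> (forall j, `|flat j x - flat j y| <= r) ->
  forall k, `|coord k x - coord k y| <= r.
Proof.
move=> r0 xy k; rewrite [leLHS]/Num.norm /= mx_normrE; apply: bigmax_le => // -[i j] _ /=.
by rewrite !mxE ord1 !(coord_flat D_gt0).
Qed.

Lemma le_flat_coord j x y :
  `|flat j x - flat j y| <= `|coord (j %/ D) x - coord (j %/ D) y|.
Proof.
rewrite [leRHS]/Num.norm /= mx_normrE.
apply: (le_trans _ (le_bigmax _ _ (ord0, Ordinal (ltn_pmod j D_gt0)))) => /=.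
by rewrite !mxE.
Qed.

Variable d : Y -> Y -> R.
Hypothesis dP : compatible_metric d.

(** The point [y] is found in a cube of side [r] near [x], so that Birkhoff sums at [y] and [x] can
    be compared. *)
Lemma large_support (V : choiceType) (K : simplicial_complex V)
    (f : Y -> polyhedron R K) (N : nat) (e r : R) (x : Y) :
  continuous f ->
  (forall y y', e <= bowen_metric sigma d N y y' -> f y <> f y') ->
  0 < r <= 1 ->
  (forall y y' k, (k < N)%N -> r <= `|coord k y - coord k y'| ->
    e <= bowen_metric sigma d N y y') ->
  exists y, (forall k, `|coord k y - coord k x| <= r) /\
    (N * D < #|` support (f y)|)%N.
Proof.
move=> cf fsep /andP[r0 r1] rsep; apply: contrapT => H.
pose n := (N * D)%N.
have supp y : (forall k, `|coord k y - coord k x| <= r) -> (#|` support (f y)| <= n)%N.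
  by move=> yx; rewrite leqNgt; apply/negP => h; apply: H; exists y.
pose t v y := bary (f y) v.
have ct v : continuous (t v).
  move=> y; apply: (@continuous_comp _ _ _ f (fun a => bary a v)); first exact: cf.
  exact: bary_continuous.
have cC : compact [set z : Y * Y | e <= bowen_metric sigma d N z.1 z.2].
  apply: (subclosed_compact _ cube_sequences2_compact) => //.
  apply: (@closed_comp _ _ _ [set s | e <= s]) => [z _|]; last exact: closed_ge.
  exact: (@bowen_metric_continuous R Y d dP sigma N left_shift_continuous).
have cnt v := increment_continuous (ct v).
(* Separated points have different images; by compactness some barycentric coordinate from the
   finite set [S] tells them apart by more than [delta]. *)
have [[y y'] /= eyy|S [delta [delta0 Sdelta]]] := compact_positive cC cnt.
  apply: contrapT => /forallNP h; apply: (fsep _ _ eyy); apply: bary_inj => v.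
  by apply/eqP; rewrite -subr_eq0 -normr_eq0 -[_ == 0]negbK -normr_gt0 normr_id; apply/negP/h.
pose P := \sum_(j < n) phase n j : R.
(* Two demands on [M]: [M + P] is a half-integer, as [good_phase] requires, and [M * delta] exceeds
   1. *)
pose m : int := Posz (Num.bound (delta^-1 + P)).
pose M : R := m%:~R + 1 / 2 - P.
have P0 : 0 <= P by apply: sumr_ge0 => j _; rewrite divr_ge0.
have Mdelta : delta^-1 < M.
  have := @archi_boundP _ (delta^-1 + P) (addr_ge0 (ltW _) P0).
  by rewrite invr_gt0 => /(_ delta0); rewrite /M /m -pmulrn; lra.
have M0 : 0 < M by apply: lt_trans Mdelta; rewrite invr_gt0.
have MP : M + P = m%:~R + 1 / 2 by rewrite /M subrK.
have gap0 : 0 < phase_gap n :> R by exact: phase_gap_gt0.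
pose g (z : Y * Y) := \sum_(v <- S) `|M * t v z.1 - M * t v z.2|.
have cg : continuous g.
  apply: (@sum_increment_continuous R Y V S (fun v y => M * t v y)) => v.
  exact: scale_continuous.
have [z|L [rho [rho0 Lrho]]] := modulus_of_continuity cg _ gap0.
  by rewrite /g big1// => v _; rewrite subrr normr0.
have unif y y' v : v \in S -> (forall k, `|coord k y - coord k y'| <= rho) ->
    `|M * t v y - M * t v y'| < phase_gap n.
  move=> vS yy'; apply: le_lt_trans (Lrho y y' (fun k _ => yy' k)).
  by rewrite /g (big_fsetD1 v)//= lerDl sumr_ge0.
(* The mesh [1 / k] is at most [rho], so within a grid cell the scaled coordinates in [S] move by
   less than [phase_gap]. *)
pose k := (Num.bound rho^-1).+1.
have k0 : 0 < k%:R :> R by rewrite ltr0n.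
have krho : k%:R^-1 <= rho.
  rewrite -[rho]invrK lef_pV2 ?posrE ?invr_gt0//.
  have := @archi_boundP _ rho^-1 (ltW _); rewrite invr_gt0 => /(_ rho0) /ltW.
  by move/le_trans; apply; rewrite ler_nat.
(* Grid points are arbitrary tuples of naturals, hence the truncation at 1. *)
pose c (p : 'I_n -> nat) (j : 'I_n) : R := Num.min ((p j)%:R / k%:R) 1.
have c01 p j : 0 <= c p j <= 1.
  by rewrite /c le_min ler01 ge_min lexx orbT andbT divr_ge0.
(* The convex combination with [x] stays in [[0,1]], has range of length [r], and moves each
   coordinate by at most [r]; coordinates from [n] on are those of [x]. *)
pose q p (j : nat) := if insub j is Some i then (1 - r) * flat j x + r * c p i else flat j x.
have q01 p j : 0 <= q p j <= 1.
  have := flat_itv D_gt0 j x; rewrite /q; case: insubP => // i _ _ /andP[x0 x1].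
  have /andP[c0 c1] := c01 p i; nra.
pose y p := unflat (q p).
have flaty p (j : 'I_n) : flat j (y p) = (1 - r) * flat j x + r * c p j.
  by rewrite flat_unflat// /q valK.
have flaty' p j : (n <= j)%N -> flat j (y p) = flat j x.
  by move=> nj; rewrite flat_unflat// /q insubF// ltnNge nj.
have yx p l : `|coord l (y p) - coord l x| <= r.
  apply: le_coord_flat => [|j]; first exact: ltW.
  have [jn|nj] := ltnP j n; last by rewrite flaty'// subrr normr0 ltW.
  rewrite (flaty p (Ordinal jn))/=.
  have /andP[c0 c1] := c01 p (Ordinal jn); have /andP[x0 x1] := flat_itv D_gt0 j x.
  by rewrite ler_norml; apply/andP; split; nra.
have yy p p' : (forall l, p l <= p' l <= (p l).+1)%N ->
    forall l, `|coord l (y p) - coord l (y p')| <= rho.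
  move=> pp'; apply: le_coord_flat => [|j]; first exact: ltW.
  have [jn|nj] := ltnP j n; last by rewrite !flaty'// subrr normr0 ltW.
  rewrite !(flaty _ (Ordinal jn))/= opprD addrACA subrr add0r -mulrBr normrM.
  rewrite (gtr0_norm r0) (le_trans _ krho)//.
  apply: (@le_trans _ _ `|c p (Ordinal jn) - c p' (Ordinal jn)|).
    by rewrite ler_piMl.
  have /andP[pp p'p] := pp' (Ordinal jn).
  have h1 : (p (Ordinal jn))%:R / k%:R <= (p' (Ordinal jn))%:R / k%:R :> R.
    by rewrite ler_pM2r ?invr_gt0// ler_nat.
  have h2 : (p' (Ordinal jn))%:R / k%:R <= (p (Ordinal jn))%:R / k%:R + k%:R^-1 :> R.
    by rewrite -[X in _ + X]mul1r -mulrDl ler_pM2r ?invr_gt0// natr1 ler_nat.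
  rewrite /c; move: h1 h2; set a := _ / _; set b := _ / _ => ab ba.
  have kV : 0 < k%:R^-1 :> R by rewrite invr_gt0.
  rewrite ler_norml; case: (leP a 1) => ?; case: (leP b 1) => ?;
    by apply/andP; split; lra.
pose W j y v : int := Num.floor (M * t v y + phase n j).
(* The predicate [u j] compares the floors at phase [j] with those on the near face in direction
   [j]. On the far face they cannot agree: equal floors would make all coordinates in [S] differ by
   at most [1 / M], which is below [delta]. *)
pose u (j : 'I_n) p := `[< exists p', p' j = 0%N /\
  forall v, v \in S -> W j (y p') v = W j (y p) v >].
have u0 j p : p j = 0%N -> u j p by move=> pj; apply/asboolP; exists p.
have uk j p : p j = k -> ~~ u j p.
  move=> pj; apply/asboolPn => -[p' [p'j WE]].
  have : r <= `|coord (j %/ D) (y p) - coord (j %/ D) (y p')|.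
    apply: le_trans (le_flat_coord j _ _); rewrite !flaty /c pj p'j mul0r divff ?gt_eqF//.
    by rewrite (min_l ler01) minxx mulr1 mulr0 addr0 addrC addKr ger0_norm// ltW.
  have jN : (j %/ D < N)%N by rewrite ltn_divLR.
  move=> /(rsep _ _ _ jN) /(Sdelta (y p, y p'))[v vS] /=.
  apply/negP; rewrite -leNgt -(ler_pM2l M0).
  apply: (@le_trans _ _ 1); last first.
    by rewrite -(ler_pM2r (_ : 0 < delta^-1)) ?invr_gt0// mul1r mulfK ?gt_eqF// ltW.
  have := WE v vS; rewrite /W => Ev; rewrite -(ger0_norm (ltW M0)) -normrM mulrBr.
  have /andP[a1 a2] := floor_itv (M * t v (y p) + phase n j).
  have /andP[b1 b2] := floor_itv (M * t v (y p') + phase n j).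
  move: b1 b2; rewrite Ev; move: a1 a2; rewrite intrD => a1 a2 b1 b2.
  by rewrite ler_norml; apply/andP; split; lra.
have [p up] := discrete_poincare_miranda u0 uk.
(* At this phase no scaled coordinate of [f (y p)] is near an integer, so the floors, and with them
   [u j], are constant on the cell of [p]. *)
have [j jgood] : exists j : 'I_n, forall v (z : int),
    phase_gap n < `|M * t v (y p) + phase n j - z%:~R|.
  apply: (good_phase MP (supp _ (yx p))) => [v|].
    by rewrite mem_support negbK => /eqP.
  by apply: sum_support; exact: fsubset_refl.
have WE p' v : (forall l, p l <= p' l <= (p l).+1)%N -> v \in S ->
    W j (y p') v = W j (y p) v.
  move=> pp' vS; apply/esym/(eq_floor (jgood v)).
  by rewrite opprD addrACA subrr addr0; apply: unif => //; exact: yy.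
have uE p' : (forall l, p l <= p' l <= (p l).+1)%N -> u j p' = u j p.
  move=> pp'; apply/asboolP/asboolP => -[p0 [p0j E]]; exists p0; split => // v vS.
    by rewrite E// WE.
  by rewrite E// WE.
have [p1 [p2 [pp1 pp2]]] := up j.
by rewrite !uE// eqxx.
Qed.

(** [r] bounds the change of [phi] by [eta] at each time, and [e0] is chosen for this [r]; neither
    depends on [N]. *)
Lemma Widim_lower_bound (phi : Y -> R) (eta : R) : continuous phi -> 0 < eta ->
  exists2 e0, 0 < e0 & forall eps N x, eps <= e0 ->
  ((((N * D)%:R + birkhoff_sum sigma phi N x - N%:R * eta)%:E <=
   Widim eps (bowen_metric sigma d N) (birkhoff_sum sigma phi N))%E).
Proof.
move=> cphi eta0.
have [y|L [rho [rho0 Lrho]]] :=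
    modulus_of_continuity (increment_continuous cphi) _ eta0.
  by rewrite subrr normr0.
pose r := Num.min rho 1.
have r0 : 0 < r by rewrite lt_min rho0 ltr01.
have r1 : r <= 1 by rewrite ge_min lexx orbT.
have [e0 e00 e0r] := dist_coord0 dP r0.
exists e0 => // eps N x epse0; apply: Widim_ge => V K f [cf femb].
have [y y'|||y [yx ysupp]] := @large_support V K f N eps r x cf.
- apply: contraPnot => fyy'; rewrite leNgt; apply/negP/negPn.
  rewrite -lte_fin; apply: le_lt_trans (femb (f y)).
  by apply: ereal_sup_ubound; exists y => //; exists y'.
- by rewrite r0.
- move=> y y' k kN /= h; apply: le_trans epse0 _; apply: le_trans (le_bowen_metric _ _ _ _ kN).
  by apply/ltW/e0r; rewrite !coord_iter addn0.
exists y; apply: (@le_trans _ _ ((N * D)%:R + birkhoff_sum sigma phi N y)%:E).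
  rewrite lee_fin -addrA lerD2l lerBlDl -lerBlDr /birkhoff_sum -sumrB.
  rewrite mulrC mulr_natr -[X in eta *+ X]subn0 -sumr_const_nat.
  rewrite ler_sum_nat// => n _.
  apply: le_trans (ler_norm _) _; rewrite distrC; apply/ltW.
  apply: (Lrho (iter n sigma y) (iter n sigma x)) => l _.
  by rewrite /= !coord_iter (le_trans (yx _))// ge_min lexx.
rewrite EFinD; apply: leeD => //.
(* More than [N * D] vertices span a simplex of dimension at least [N * D]. *)
apply: le_trans (local_dim_ge (simplices_support (f y)) (fsubset_refl _)).
by rewrite lee_fin ler_nat -ltnS (ltn_predK ysupp).
Qed.

End lower_bound.

(** * Invariant measures *)

Section borel_integration.
Context {R : realType} {Y : ptopologicalType}.
Implicit Types (T : Y -> Y) (phi : Y -> R).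

Lemma continuous_borel_measurable phi :
  continuous phi -> measurable_fun [set: borel Y] (phi : borel Y -> R).
Proof.
move=> cphi; apply: (measurability _ (RGenOInfty.measurableE R)).
move=> _ [_ [r ->] <-]; rewrite setTI; apply: sub_sigma_algebra.
by apply: open_comp => [y _|]; [exact: cphi|exact: interval_open].
Qed.

Lemma continuous_borel_measurable_self T : continuous T ->
  measurable_fun [set: borel Y] (T : borel Y -> borel Y).
Proof.
move=> cT; apply: (@measurability _ _ (borel Y) (borel Y) setT T (@open Y)) => //.
move=> _ [B oB <-]; rewrite setTI; apply: sub_sigma_algebra.
by apply: open_comp => // y _; exact: cT.
Qed.

Hypothesis cY : compact [set: Y].

Lemma continuous_bounded phi : continuous phi -> exists C, forall y, `|phi y| <= C.
Proof.
move=> cphi; have := continuous_compact (continuous_subspaceT cphi) cY.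
move=> /compact_bounded[M [_ HM]]; exists (M + 1) => y.
by apply: HM; [rewrite ltrDl|exists y].
Qed.

Lemma continuous_integrable phi (mu : probability (borel Y) R) : continuous phi ->
  mu.-integrable setT (EFin \o phi).
Proof.
move=> cphi; apply: measurable_bounded_integrable => //.
- exact: le_lt_trans (probability_le1 mu (measurableT : measurable [set: borel Y])) (ltry _).
- exact: continuous_borel_measurable.
have [C HC] := continuous_bounded cphi; exists C; split; first exact: num_real.
by move=> x Cx y _; exact: le_trans (HC y) (ltW Cx).
Qed.

Lemma invariant_integral T phi (mu : probability (borel Y) R) n : continuous T ->
  continuous phi -> invariant_probabilities R T mu ->
  (\int[mu]_y (phi (iter n T y))%:E = \int[mu]_y (phi y)%:E)%E.
Proof.
move=> cT cphi muT; elim: n => [//|n <-].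
have cphin : continuous (phi \o iter n T).
  by move=> y; apply: continuous_comp; [exact: iter_continuous|exact: cphi].
transitivity (\int[pushforward mu (T : borel Y -> borel Y)]_y (phi (iter n T y))%:E)%E.
  rewrite (integral_pushforward (continuous_borel_measurable_self cT))//=.
  - by apply: eq_integral => y _; rewrite /= -iterS iterSr.
  - by apply/measurable_EFinP; exact: (continuous_borel_measurable cphin).
  - rewrite preimage_setT; apply: (@continuous_integrable (phi \o iter n T \o T)).
    by move=> y; apply: continuous_comp; [exact: cT|exact: cphin].
apply: eq_measure_integral => [|mT A mA _]; last exact: muT.
exact: continuous_borel_measurable_self.
Qed.

(** By invariance the left side is the integral of the Birkhoff sum. *)
Lemma invariant_integral_le T phi (mu : probability (borel Y) R) N (a : R) :
  continuous T -> continuous phi -> invariant_probabilities R T mu ->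
  (forall y, birkhoff_sum T phi N y <= a) ->
  (N%:R%:E * \int[mu]_y (phi y)%:E <= a%:E)%E.
Proof.
move=> cT cphi muT phia.
have cphin n : continuous (phi \o iter n T).
  by move=> y; apply: continuous_comp; [exact: iter_continuous|exact: cphi].
have -> : (N%:R%:E * \int[mu]_y (phi y)%:E =
    \int[mu]_y (\sum_(0 <= n < N) (phi (iter n T y))%:E))%E.
  rewrite integral_sum//=; last by move=> n; exact: continuous_integrable (cphin n).
  under eq_bigr do rewrite invariant_integral//.
  by rewrite sumr_const_nat subn0 mule_natl.
have -> : a%:E = (\int[mu]_y cst a%:E y)%E.
  have mu1 : mu [set: borel Y] = 1%E := probability_setT mu.
  by rewrite integral_cst// [X in (_ * X)%E]mu1 mule1.
apply: le_integral => //.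
- by apply: integrable_sum => // n _; exact: continuous_integrable (cphin n).
- by apply: (@continuous_integrable (cst a)); exact: cst_continuous.
- by move=> y _; rewrite sumEFin lee_fin; exact: phia.
Qed.

End borel_integration.

Lemma cyclic_sum (V : nmodType) (f : nat -> V) n : f n = f 0%N ->
  \sum_(i < n) f i.+1 = \sum_(i < n) f i.
Proof.
by case: n => [|n] fn; rewrite ?big_ord0// big_ord_recr big_ord_recl /= fn addrC.
Qed.

(** * Measures on periodic orbits *)

Section periodic_orbit.
Context {R : realType} {Y : ptopologicalType} (T : Y -> Y) (y : Y) (N : nat).
Hypothesis N_gt0 : (0 < N)%N.

Let weight : {nonneg R} := (N%:R^-1)%:nng.

Definition orbit_measure : set (borel Y) -> \bar R :=
  mscale weight (msum (fun i => \d_(iter i T y : borel Y)) N).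

HB.instance Definition _ := Measure.on orbit_measure.

Lemma orbit_measureE (A : set (borel Y)) : orbit_measure A =
  ((N%:R^-1)%:E * \sum_(i < N) \d_(iter i T y : borel Y) A)%E.
Proof. by []. Qed.

Let orbit_measure_setT : orbit_measure setT = 1%E.
Proof.
rewrite orbit_measureE; under eq_bigr do rewrite diracT.
rewrite (sumEFin _ _ (fun=> 1%R)) sumr_const card_ord -EFinM mulVf//.
by rewrite pnatr_eq0 -lt0n.
Qed.

HB.instance Definition _ := Measure_isProbability.Build _ _ _ orbit_measure
  orbit_measure_setT.

Hypothesis y_periodic : iter N T y = y.

Lemma orbit_measure_invariant : invariant_probabilities R T orbit_measure.
Proof.
move=> A mA; change (orbit_measure (T @^-1` A) = orbit_measure A).
rewrite !orbit_measureE; congr (_ * _)%E.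
rewrite -[RHS](cyclic_sum (f := fun i => \d_(iter i T y : borel Y) A)).
  by apply: eq_bigr => i _; rewrite !diracE.
by rewrite y_periodic.
Qed.

Lemma integral_orbit_measure (phi : Y -> R) : compact [set: Y] -> continuous phi ->
  (\int[orbit_measure]_x (phi x)%:E = (birkhoff_sum T phi N y / N%:R)%:E)%E.
Proof.
move=> cY cphi; have [C phiC] := continuous_bounded cY cphi.
have N0 : N%:R != 0 :> R by rewrite pnatr_eq0 -lt0n.
(* Adding the bound [C] makes the integrand nonnegative, as needed to integrate against scaled sums
   of measures; it is subtracted again at the end. *)
pose psi x := phi x + C.
have cpsi : continuous psi.
  by move=> x; apply: cvgD; [exact: cphi|exact: cvg_cst].
have psi0 x : 0 <= psi x.
  by have := phiC x; rewrite ler_norml /psi => /andP[h _]; rewrite -lerBlDr sub0r.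
have mpsi : measurable_fun [set: borel Y] (EFin \o psi : borel Y -> \bar R).
  by apply/measurable_EFinP; exact: continuous_borel_measurable.
have Epsi : (\int[orbit_measure]_x (psi x)%:E = (birkhoff_sum T phi N y / N%:R + C)%:E)%E.
  rewrite ge0_integral_mscale//=; last by move=> x _; rewrite lee_fin.
  rewrite ge0_integral_measure_sum//=; last by move=> x _; rewrite lee_fin.
  under eq_bigr do rewrite integral_dirac// diracT mul1e.
  rewrite sumEFin -EFinM; congr (_%:E).
  rewrite /psi big_split/= sumr_const card_ord mulrDr -[C *+ N]mulr_natl mulKf//.
  by rewrite /birkhoff_sum big_mkord mulrC.
have iphi := continuous_integrable cY orbit_measure cphi.
have -> : (\int[orbit_measure]_x (phi x)%:E =
    \int[orbit_measure]_x ((psi x)%:E - (cst C x)%:E))%E.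
  by apply: eq_integral => x _; rewrite /psi -EFinB addrK.
rewrite integralB//=; [|exact: (continuous_integrable cY orbit_measure cpsi)|].
  rewrite Epsi integral_cst// [X in (_ * X)%E]orbit_measure_setT mule1.
  by rewrite -EFinB addrK.
by apply: (@continuous_integrable _ _ cY (cst C)); exact: cst_continuous.
Qed.

End periodic_orbit.

(** * Birkhoff sums and the supremum over invariant measures *)

Section ergodic_supremum.
Context {R : realType} {D : nat}.
Local Notation Y := (cube_sequences R D).
Local Notation sigma := (@left_shift R D).
Implicit Types x y : Y.
Variable phi : Y -> R.
Hypothesis phi_cont : continuous phi.

Definition periodize (N : nat) x : Y := fun k => x (k %% N)%N.

Lemma iter_periodize N x : iter N sigma (periodize N x) = periodize N x.
Proof.
by apply/funext => k; rewrite left_shift_iter /periodize modnDl.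
Qed.

Lemma birkhoff_sum_periodize eta : 0 < eta -> exists B, forall N x,
  birkhoff_sum sigma phi N x <=
    birkhoff_sum sigma phi N (periodize N x) + N%:R * eta + B.
Proof.
move=> eta0.
have [C phiC] := continuous_bounded cube_sequences_compact phi_cont.
have C0 : 0 <= C by exact: le_trans (phiC point).
have [y|L [rho [rho0 Lrho]]] :=
    modulus_of_continuity (increment_continuous phi_cont) _ eta0.
  by rewrite subrr normr0.
(* Before time [N - L] the two orbits agree in the first [L] coordinates; each of the at most [L]
   remaining terms costs at most [2 * C]. *)
exists (L%:R * (2 * C)) => N x.
rewrite -addrA -lerBlDl /birkhoff_sum -sumrB.
rewrite (big_cat_nat (n := (N - L)%N)) ?leq_subr//=; apply: lerD.
  apply: (@le_trans _ _ (\sum_(0 <= n < N - L) eta)).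
    rewrite !big_nat; apply: ler_sum => n /andP[_]; rewrite ltn_subRL => nNL.
    apply: le_trans (ler_norm _) _; apply/ltW.
    apply: (Lrho (iter n sigma x) (iter n sigma (periodize N x))) => k kL.
    rewrite !coord_iter /coord /periodize modn_small ?subrr ?normr0 ?(ltW rho0)//.
    by rewrite addnC (ltn_trans _ nNL)// ltn_add2r.
  rewrite sumr_const_nat subn0 -[_ *+ _]mulr_natl ler_wpM2r ?(ltW eta0)//.
  by rewrite ler_nat leq_subr.
apply: (@le_trans _ _ (\sum_(N - L <= n < N) (2 * C))).
  apply: ler_sum => n _; have := phiC (iter n sigma x).
  have := phiC (iter n sigma (periodize N x)).
  by rewrite !ler_norml => /andP[? ?] /andP[? ?]; lra.
rewrite sumr_const_nat -[_ *+ _]mulr_natl ler_wpM2r ?mulr_ge0// ler_nat.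
by rewrite leq_subLR addnC -leq_subLR.
Qed.

(** Invariance bounds every integral by the largest Birkhoff average; conversely, orbit measures of
    periodized points nearly attain these averages. *)
Lemma ergodic_supremum : exists A : R,
  [/\ ereal_sup [set \int[mu]_x (phi x)%:E | mu in invariant_probabilities R sigma]%E
        = A%:E,
      forall N a, (0 < N)%N -> (forall x, birkhoff_sum sigma phi N x <= a) ->
        N%:R * A <= a &
      forall eta, 0 < eta -> exists B, forall N x, (0 < N)%N ->
        birkhoff_sum sigma phi N x <= N%:R * (A + eta) + B].
Proof.
set s := ereal_sup _.
have cY := @cube_sequences_compact R D.
have cs := @left_shift_continuous R D.
have s_le N a : (0 < N)%N -> (forall x, birkhoff_sum sigma phi N x <= a) ->
    (s <= (a / N%:R)%:E)%E.
  move=> N0 Sa; apply: ge_ereal_sup => _ [mu muT <-].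
  have := invariant_integral_le cY cs phi_cont muT Sa.
  have /fineK <- := integrable_fin_num measurableT (continuous_integrable cY mu phi_cont).
  by rewrite -EFinM !lee_fin ler_pdivlMr ?ltr0n// mulrC.
have s_ge N x : (0 < N)%N ->
    ((birkhoff_sum sigma phi N (periodize N x) / N%:R)%:E <= s)%E.
  move=> N0; rewrite -(integral_orbit_measure _ _ N0 cY phi_cont).
  apply: ereal_sup_ubound; exists (orbit_measure sigma (periodize N x) N) => //.
  exact: (orbit_measure_invariant N0 (iter_periodize N x)).
have [C phiC] := continuous_bounded cY phi_cont.
have sfin : s \is a fin_num.
  apply/fin_numPlt; apply/andP; split.
    by apply: lt_le_trans (s_ge 1%N point isT); rewrite ltNyr.
  apply: (@le_lt_trans _ _ (C / 1%:R)%:E); last by rewrite ltry.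
  apply: s_le => // x; rewrite /birkhoff_sum big_nat1 /=.
  exact: le_trans (ler_norm _) (phiC x).
have sE := fineK sfin; set A := fine s in sE.
exists A; split=> //.
  move=> N a N0 Sa; have := s_le N a N0 Sa.
  by rewrite -sE lee_fin ler_pdivlMr ?ltr0n// mulrC.
move=> eta eta0; have [B SB] := birkhoff_sum_periodize eta0.
exists B => N x N0; apply: le_trans (SB N x) _; rewrite lerD2r mulrDr lerD2r.
have := s_ge N x N0.
by rewrite -sE lee_fin ler_pdivrMr ?ltr0n// mulrC.
Qed.

End ergodic_supremum.

(** * Existence and value of the two limits *)

Theorem theorem2 (R : realType) (D : nat) (D_ge1 : (1 <= D)%N)
    (phi : cube_sequences R D -> R) (phi_cont : continuous phi)
    (d : cube_sequences R D -> cube_sequences R D -> R)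
    (d_metric : compatible_metric d) :
  mdim_exists (@left_shift R D) phi d /\
  mdim (@left_shift R D) phi d =
    (D%:R%:E + ereal_sup
      [set \int[mu]_x (phi x)%:E
        | mu in invariant_probabilities R (@left_shift R D)])%E.
Proof.
have cY := @cube_sequences_compact R D.
have cs := @left_shift_continuous R D.
have [A [-> A_le A_ge]] := ergodic_supremum phi_cont.
have [C phiC] := continuous_bounded cY phi_cont.
pose W eps N := Widim eps (bowen_metric (@left_shift R D) d N)
  (birkhoff_sum (@left_shift R D) phi N).
have phiNC N x : `|birkhoff_sum (@left_shift R D) phi N x| <= N%:R * C.
  apply: le_trans (ler_norm_sum _ _ _) _.
  rewrite mulr_natl -[X in C *+ X]subn0 -sumr_const_nat.
  by apply: ler_sum => n _.
(* Local dimensions are nonnegative, so any point gives a linear lower bound, which Fekete's lemma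
   uses. *)
have W_ge eps N : ((- C * N%:R)%:E <= W eps N)%E.
  apply: Widim_ge => V K f _; exists point.
  rewrite -[leLHS]add0e; apply: leeD; first exact: local_dim_ge0.
  rewrite lee_fin mulNr mulrC.
  by have := phiNC N point; rewrite ler_norml => /andP[].
have Wfin eps N : 0 < eps -> W eps N \is a fin_num.
  move=> eps0; apply/fin_numPlt; apply/andP; split.
    by apply: lt_le_trans (W_ge eps N); rewrite ltNyr.
  have [L LW] := Widim_upper_bound D_ge1 phi d_metric eps0.
  apply: le_lt_trans (LW N (N%:R * C) _) _; last by rewrite ltry.
  by move=> x; exact: le_trans (ler_norm _) (phiNC N x).
pose w eps N := fine (W eps N).
have wE eps N : 0 < eps -> W eps N = (w eps N)%:E by move=> /(Wfin eps N)/fineK.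
have rateE eps : 0 < eps ->
    Widim_rate (@left_shift R D) phi d eps = EFin \o (fun N => w eps N / N%:R).
  by move=> eps0; apply/funext => N; rewrite /Widim_rate -/(W eps N) wE.
have w_cvg eps : 0 < eps -> cvgn (fun N => w eps N / N%:R).
  move=> eps0; apply: (@Widim_rate_cvg _ _ _ phi d cY cs eps (- C)).
    by move=> N; rewrite -/(W eps N) wE.
  by move=> N; rewrite -lee_fin -wE.
have rate_cvg eps : 0 < eps -> Widim_rate (@left_shift R D) phi d eps @ \oo -->
    (limn (fun N => w eps N / N%:R))%:E.
  by move=> eps0; rewrite rateE//; apply: cvg_EFin => //; [exact: nearW|exact: w_cvg].
pose l eps := limn (fun N => w eps N / N%:R).
have scaleE eps : 0 < eps -> mdim_at_scale (@left_shift R D) phi d eps = (l eps)%:E.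
  by move=> eps0; apply/cvg_lim => //; exact: rate_cvg.
have l_le eps : 0 < eps -> l eps <= D%:R + A.
  move=> eps0; apply/ler_addgt0Pr => eta eta0.
  have [L LW] := Widim_upper_bound D_ge1 phi d_metric eps0.
  have [B SB] := A_ge eta eta0.
  (* The part of the upper bound independent of [N], which disappears after division by [N]. *)
  pose K := L%:R * D%:R + B.
  have cK : (fun N => D%:R + A + eta + K * N%:R^-1) @ \oo --> D%:R + A + eta.
    rewrite -[X in _ --> X]addr0 -(mulr0 K); apply: cvgD; first exact: cvg_cst.
    by apply: cvgMr; rewrite -cvg_shiftS; exact: cvg_harmonic.
  apply: (ler_cvg_to (w_cvg eps eps0) cK); exists 1%N => // N /= N1.
  have N0 : 0 < N%:R :> R by rewrite ltr0n.
  rewrite ler_pdivrMr// mulrDl mulfVK ?gt_eqF//.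
  have := LW N _ (fun x => SB N x N1).
  rewrite -/(W eps N) wE// lee_fin natrM natrD /K => /le_trans; apply.
  by rewrite le_eqVlt; apply/orP; left; apply/eqP; ring.
have l_ge eta : 0 < eta -> exists2 e0, 0 < e0 &
    forall eps, 0 < eps <= e0 -> D%:R + A - eta <= l eps.
  move=> eta0; have [e0 e00 He0] := Widim_lower_bound D_ge1 d_metric phi_cont eta0.
  exists e0 => // eps /andP[eps0 epse0].
  apply: limr_ge; first exact: w_cvg.
  exists 1%N => // N /= N1; have N0 : 0 < N%:R :> R by rewrite ltr0n.
  rewrite ler_pdivlMr//.
  (* The lower bound on the width, read backwards, bounds all Birkhoff sums of length [N], hence
     also [N * A]. *)
  have := A_le N (w eps N - (N * D)%:R + N%:R * eta) N1.
  have Sw x : birkhoff_sum (@left_shift R D) phi N x <= w eps N - (N * D)%:R + N%:R * eta.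
    by have := He0 eps N x epse0; rewrite -/(W eps N) wE// lee_fin; lra.
  by move=> /(_ Sw); rewrite natrM; nra.
have cvg_scale : mdim_at_scale (@left_shift R D) phi d eps @[eps --> 0^'+] -->
    (D%:R + A)%:E.
  apply: cvg_EFin.
    by near=> eps; rewrite scaleE.
  apply/cvgrPdist_le => eta eta0; have [e0 e00 le0] := l_ge eta eta0.
  near=> eps; have eps0 : 0 < eps by near: eps; exact: nbhs_right_gt.
  have epse0 : eps <= e0 by near: eps; exact: nbhs_right_le.
  rewrite /= scaleE//= ger0_norm ?subr_ge0 ?l_le// lerBlDr -lerBlDl.
  by apply: le0; rewrite eps0.
split; last by rewrite -EFinD; apply/cvg_lim.
split=> [eps eps0|]; last by apply/cvg_ex; exists (D%:R + A)%:E.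
by apply/cvg_ex; exists (l eps)%:E; exact: rate_cvg.
Unshelve. all: by end_near. Qed.
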